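(* Let $E$ be a complex Banach space and let $K$ be a compact set in $E$. Then the following are equivalent. (i) The set $K$ is polynomially convex in $E$. (ii) There is a unital commutative Banach algebra $A$ and a continuous function $f:B_{E^*}\to A$ such that $A$ is generated by $f(B_{E^*})$ and $K=\mathrm{Sp}(f)$, the joint spectrum of $f$ (where $K$ is regarded as a subset of $C(B_{E^*})$ via $x\mapsto \tilde x$). Moreover, $K$ is homeomorphic to the character space $\mathfrak{M}(A)$.
   Context: $B_{E^*}$ denotes the closed unit ball of the dual space $E^*$, a compact Hausdorff space in the weak* topology. For $x\in E$, $\tilde x:B_{E^*}\to\mathbb{C}$, $\tilde x(\phi)=\phi(x)$, is continuous with $\|\tilde x\|_{B_{E^*}}=\|x\|$, so $x\mapsto\tilde x$ identifies $E$ isometrically with a closed subspace of $C(B_{E^*})$. Polynomials on $E$ are polynomials of finite type, i.e. finite sums of maps $x\mapsto\phi_1(x)\cdots\phi_n(x)$ with $\phi_i\in E^*$; $\mathcal{P}(E)$ denotes this space. The polynomially convex hull of a compact $K\subset E$ is $\hat K=\{x\in E: |P(x)|\le \sup_{y\in K}|P(y)| \text{ for all } P\in\mathcal{P}(E)\}$, and $K$ is polynomially convex if $K=\hat K$. For a unital commutative Banach algebra $A$, a set $X$ and a function $f:X\to A$, the joint spectrum $\mathrm{Sp}(f)$ is the set of all functions $\lambda:X\to\mathbb{C}$ such that the ideal generated by $\{\lambda(x)\mathbf 1-f(x):x\in X\}$ is proper; equivalently $\mathrm{Sp}(f)=\{\phi\circ f:\phi\in\mathfrak{M}(A)\}$,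 where $\mathfrak{M}(A)$ is the character space of $A$. *)

(* Defs.v *)
From HB Require Import structures.
From mathcomp Require Import all_boot all_order all_algebra.
From mathcomp Require Import all_classical all_reals ereal topology normedtype.
From mathcomp.real_closed Require Import complex.
Import Order.TTheory GRing.Theory Num.Theory.
Import numFieldNormedType.Exports.
Set Implicit Arguments. Unset Strict Implicit. Unset Printing Implicit Defensive.
Local Open Scope ring_scope.
Local Open Scope classical_set_scope.

Section Defs.
Variable R : realType.
Local Notation C := (R[i]).
Local Notation normc := (@ComplexField.Normc.normc R).

Section Space.
Variable E : completeNormedModType C.

Definition clinear_fun (phi : E -> C) : Prop :=
  forall (a : C) (x y : E), phi (a *: x + y) = a * phi x + phi y.

Definition in_dual (phi : E -> C) : Prop :=
  clinear_fun phi /\ continuous (phi : E -> C^o).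

Definition in_dual_ball (phi : E -> C) : Prop :=
  in_dual phi /\ forall x : E, `|phi x| <= `|x|.

Definition finite_type_poly (P : E -> C) : Prop :=
  exists (m : nat) (n : 'I_m -> nat) (phi : forall i : 'I_m, 'I_(n i) -> E -> C),
    (forall i j, in_dual (phi i j)) /\
    forall x : E, P x = \sum_(i < m) \prod_(j < n i) phi i j x.

Definition poly_hull (K : set E) : set E :=
  [set x | forall P : E -> C, finite_type_poly P ->
     ((normc (P x))%:E <= ereal_sup [set (normc (P y))%:E | y in K])%E].

Definition poly_convex (K : set E) : Prop := K = poly_hull K.
End Space.

Record BanachAlg := {
  ba_car :> completeNormedModType C;
  ba_mul : ba_car -> ba_car -> ba_car;
  ba_one : ba_car;
  ba_mulA : forall a b c, ba_mul a (ba_mul b c) = ba_mul (ba_mul a b) c;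
  ba_mulC : forall a b, ba_mul a b = ba_mul b a;
  ba_mul1 : forall a, ba_mul ba_one a = a;
  ba_mulDl : forall a b c, ba_mul (a + b) c = ba_mul a c + ba_mul b c;
  ba_mulZl : forall (k : C) a b, ba_mul (k *: a) b = k *: ba_mul a b;
  ba_norm_mul : forall a b, `|ba_mul a b| <= `|a| * `|b|
}.

Section Alg.
Variable A : BanachAlg.

Definition alg_gen (S : set A) : set A :=
  [set a | forall T : set A,
     T (ba_one A) -> S `<=` T ->
     (forall x y, T x -> T y -> T (x + y)) ->
     (forall (k : C) x, T x -> T (k *: x)) ->
     (forall x y, T x -> T y -> T (ba_mul x y)) -> T a].

Definition generates (S : set A) : Prop := closure (alg_gen S) = setT.

Definition is_character (chi : A -> C) : Prop :=
  (forall (k : C) a b, chi (k *: a + b) = k * chi a + chi b) /\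
  (forall a b, chi (ba_mul a b) = chi a * chi b) /\
  chi (ba_one A) = 1.
End Alg.

Section Link.
Variable E : completeNormedModType C.
Variable A : BanachAlg.

Definition weakstar_continuous (f : (E -> C) -> A) : Prop :=
  forall phi0, in_dual_ball phi0 -> forall eps : R, 0 < eps ->
    exists (n : nat) (x : 'I_n -> E) (delta : R), 0 < delta /\
      forall phi, in_dual_ball phi ->
        (forall i, normc (phi (x i) - phi0 (x i)) < delta) ->
        `|f phi - f phi0| < (eps%:C)%C.

(* lambda : B_{E^*} -> C lies in the joint spectrum Sp(f): the ideal generated
   by { lambda(phi) 1 - f(phi) : phi in B_{E^*} } is proper, i.e. 1 is not in it *)
Definition in_joint_spectrum (f : (E -> C) -> A) (lambda : (E -> C) -> C) : Prop :=
  ~ exists (n : nat) (a : 'I_n -> A) (phi : 'I_n -> E -> C),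
      (forall i, in_dual_ball (phi i)) /\
      ba_one A = \sum_(i < n) ba_mul (a i) (lambda (phi i) *: ba_one A - f (phi i)).

(* K = Sp(f), K being viewed inside C(B_{E^*}) via x |-> x~ (x~(phi) = phi(x));
   functions on B_{E^*} are compared on B_{E^*} only *)
Definition spectrum_is (K : set E) (f : (E -> C) -> A) : Prop :=
  forall lambda : (E -> C) -> C,
    in_joint_spectrum f lambda <->
    exists2 x, K x & forall phi, in_dual_ball phi -> lambda phi = phi x.

Definition homeomorphic_to_character_space (K : set E) : Prop :=
  exists (h : E -> (A -> C)) (g : (A -> C) -> E),
    [/\ (forall x, K x -> is_character (h x)) /\
        (forall chi, is_character chi -> K (g chi)),
        (forall x, K x -> g (h x) = x),
        (forall chi, is_character chi -> h (g chi) = chi),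
        (forall x0, K x0 -> forall (a : A) (eps : R), 0 < eps ->
           exists2 delta : R, 0 < delta &
             forall x, K x -> `|x - x0| < (delta%:C)%C -> normc (h x a - h x0 a) < eps) &
        (forall chi0, is_character chi0 -> forall eps : R, 0 < eps ->
           exists (n : nat) (a : 'I_n -> A) (delta : R), 0 < delta /\
             forall chi, is_character chi ->
               (forall i, normc (chi (a i) - chi0 (a i)) < delta) ->
               `|g chi - g chi0| < (eps%:C)%C)].

Definition condition_ii (K : set E) (f : (E -> C) -> A) : Prop :=
  [/\ weakstar_continuous f, generates (f @` in_dual_ball (E:=E)) & spectrum_is K f].
End Link.
End Defs.

(* Main.v *)
Require Import Defs.
From HB Require Import structures.
From mathcomp Require Import all_boot all_order all_algebra.
From mathcomp Require Import all_classical all_reals ereal topology normedtype.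
From mathcomp Require Import sequences.
From mathcomp.real_closed Require Import complex.
From mathcomp Require Import ring lra.
Import Order.TTheory GRing.Theory Num.Theory.
Import numFieldNormedType.Exports.
Set Implicit Arguments. Unset Strict Implicit. Unset Printing Implicit Defensive.
Local Open Scope ring_scope.
Local Open Scope classical_set_scope.

(* For lambda in the joint spectrum of f, a Neumann series shows
   |p(lambda)| <= ||p(f)|| for every polynomial expression p in functionals of the dual
   ball; so no maximal ideals or Gelfand-Mazur theorem are needed.

   If K = Sp(f) and f(B_{E^*}) generates A, this inequality extends evaluation at x in K
   to a character of A, which gives the bijection of K with the character space.  If
   moreover 1 belonged to the ideal attached to some x, approximating its coefficients by
   polynomials in f would give a polynomial v with v(x) = 1 and sup_K |v| < 1, so x is
   outside the hull of K; hence the hull is contained in Sp(f) = K.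

   Conversely A is the uniform closure of the polynomials in C(K) and f is restriction to
   K.  A point lambda of Sp(f) satisfies |p(lambda)| <= sup_K |p|.  By Mazur's theorem K
   lies, with its rotations, in a compact convex set L; least squares on L interpolates
   lambda at finitely many functionals, and by compactness lambda is evaluation at some
   x in L, which then belongs to the hull of K. *)

Local Notation normc := (@ComplexField.Normc.normc _).

(** * Real-valued norms, compactness and completeness *)

(** The passage to the limit [e -> 0]. Only [e <= 1] has to be treated, which suits estimates for
    products and parameters of convex combinations. *)
Lemma ler_eps (R : realFieldType) (k x y : R) :
  0 <= k -> (forall e, 0 < e -> e <= 1 -> x <= y + k * e) -> x <= y.
Proof.
move=> k0 h; rewrite leNgt; apply/negP => yx.
pose e := Num.min 1 ((x - y) / (k + 1) / 2).
have k1 : 0 < k + 1 by lra.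
have d0 : 0 < (x - y) / (k + 1) / 2 by rewrite !divr_gt0 //; lra.
have e0 : 0 < e by rewrite lt_min d0 ltr01.
have e1 : e <= 1 by rewrite ge_min lexx.
have e2 : e <= (x - y) / (k + 1) / 2 by rewrite ge_min lexx orbT.
have := h e e0 e1.
have : (k + 1) * e <= (x - y) / 2.
  apply: le_trans (ler_wpM2l (ltW k1) e2) _.
  by rewrite mulrA mulrCA divff ?mulr1 // lt0r_neq0.
lra.
Qed.

Section RealNorm.
Variable R : realType.
Local Notation C := R[i].

Lemma normc_ge0 (z : C) : 0 <= normc z.
Proof. by case: z => a b; rewrite /ComplexField.Normc.normc sqrtr_ge0. Qed.

Lemma normc0 : normc (0 : C) = 0.
Proof. exact: ComplexField.Normc.normc0. Qed.

Lemma normc_real (a : R) : normc (a%:C)%C = `|a|.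
Proof. by rewrite /ComplexField.Normc.normc /= expr0n /= addr0 sqrtr_sqr. Qed.

Lemma normc1 : normc (1 : C) = 1.
Proof. exact: ComplexField.Normc.normc1. Qed.

Lemma normcM (a b : C) : normc (a * b) = normc a * normc b.
Proof. exact: ComplexField.Normc.normcM. Qed.

Lemma normcD (a b : C) : normc (a + b) <= normc a + normc b.
Proof. exact: le_normcD. Qed.

Lemma normcN (a : C) : normc (- a) = normc a.
Proof. exact: normcN. Qed.

Lemma normcB (a b : C) : normc (a - b) = normc (b - a).
Proof. by rewrite -normcN opprB. Qed.

Lemma normcV (a : C) : normc a^-1 = (normc a)^-1.
Proof. exact: ComplexField.Normc.normcV. Qed.

Lemma normc_eq0 (a : C) : (normc a == 0) = (a == 0).
Proof.
apply/eqP/eqP => [/ComplexField.Normc.eq0_normc //|->]; exact: normc0.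
Qed.

Lemma normc_tri (a b c : C) : normc (a - c) <= normc (a - b) + normc (b - c).
Proof. by rewrite -{1}[a](subrK b) -addrA; exact: normcD. Qed.

Lemma abs_normcE (z : C) : `|z| = ((normc z)%:C)%C.
Proof. by rewrite normc_def; case: z. Qed.

Lemma normc_ge_Re (z : C) : `|complex.Re z| <= normc z.
Proof. by rewrite -lecR -abs_normcE; exact: normc_ge_Re. Qed.

Lemma normc_ge_Im (z : C) : `|complex.Im z| <= normc z.
Proof.
case: z => a b; rewrite /ComplexField.Normc.normc /= -[leLHS]sqrtr_sqr.
by rewrite ler_sqrt ?addr_ge0 ?sqr_ge0 // lerDr sqr_ge0.
Qed.

Lemma normc_le_ReIm (z : C) : normc z <= `|complex.Re z| + `|complex.Im z|.
Proof.
rewrite [in leLHS](complexE z); apply: le_trans (normcD _ _) _.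
rewrite normcM !normc_real /=.
by rewrite expr0n add0r expr1n sqrtr1 mul1r.
Qed.

Lemma normc_sqr (z : C) : (normc z) ^+ 2 = complex.Re z ^+ 2 + complex.Im z ^+ 2.
Proof. by case: z => a b /=; rewrite sqr_sqrtr // addr_ge0 ?sqr_ge0. Qed.

Section Vec.
Variable V : normedModType C.

(** The norm of a space over [C] is itself [C]-valued; its real part carries the same information
    and makes real arithmetic applicable. *)
Definition nr (x : V) : R := complex.Re `|x|.

Lemma nrE (x : V) : `|x| = ((nr x)%:C)%C.
Proof. by rewrite RRe_real // realE normr_ge0. Qed.

Lemma nr_ge0 x : 0 <= nr x.
Proof. by rewrite -lecR -nrE normr_ge0. Qed.

Lemma nr0 : nr 0 = 0.
Proof. by rewrite /nr normr0. Qed.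

Lemma nrD x y : nr (x + y) <= nr x + nr y.
Proof. by rewrite -lecR rmorphD /= -!nrE ler_normD. Qed.

Lemma nrZ (a : C) x : nr (a *: x) = normc a * nr x.
Proof. by apply: complexI; rewrite rmorphM /= -!nrE normrZ abs_normcE. Qed.

Lemma nrN x : nr (- x) = nr x.
Proof. by rewrite /nr normrN. Qed.

Lemma nrB x y : nr (x - y) = nr (y - x).
Proof. by rewrite -nrN opprB. Qed.

Lemma nr_eq0 x : nr x <= 0 -> x = 0.
Proof.
move=> h; have h0 : nr x = 0 by apply/eqP; rewrite eq_le h nr_ge0.
by apply/eqP; rewrite -normr_eq0 nrE h0.
Qed.

Lemma nr_tri x y z : nr (x - z) <= nr (x - y) + nr (y - z).
Proof. by rewrite -{1}[x](subrK y) -addrA; exact: nrD. Qed.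

Lemma nr_le_lt x (e : R) : (`|x| < (e%:C)%C) = (nr x < e).
Proof. by rewrite nrE ltcR. Qed.

Lemma ball_nr (x : V) (e : R) y : ball x (e%:C)%C y = (nr (x - y) < e) :> Prop.
Proof. by rewrite -ball_normE /= nr_le_lt. Qed.

Lemma gt0_complex (e : C) : 0 < e -> 0 < complex.Re e /\ e = ((complex.Re e)%:C)%C.
Proof.
move=> e0; have re : e = ((complex.Re e)%:C)%C by rewrite RRe_real // gtr0_real.
by split => //; rewrite -ltcR -re.
Qed.

Lemma nbhs_nr (x : V) (B : set V) :
  nbhs x B <-> exists2 e : R, 0 < e & forall y, nr (x - y) < e -> B y.
Proof.
split.
  move/nbhs_ballP => [e /= /gt0_complex[e0 ee] h]; exists (complex.Re e) => // y hy.
  by apply: h; rewrite ee ball_nr.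
move=> [e e0 h]; apply/nbhs_ballP; exists (e%:C)%C; first by rewrite /= ltcR.
by move=> y; rewrite ball_nr; exact: h.
Qed.

(* If P K fails, the sets whose complement in K satisfies P form a proper filter
   containing K, and a cluster point contradicts the local hypothesis. *)
Lemma compact_ind (K : set V) (P : set V -> Prop) : compact K ->
  (forall S T, S `<=` T -> P T -> P S) -> P set0 ->
  (forall S T, P S -> P T -> P (S `|` T)) ->
  (forall x, K x -> exists2 e : R, 0 < e & P [set y | K y /\ nr (x - y) < e]) ->
  P K.
Proof.
move=> cK mono P0 PU loc; apply: contrapT => nPK.
pose F : set_system V := fun B => P (K `\` B).
have FF : ProperFilter F.
  apply: Build_ProperFilter.
    by rewrite /F setD0.
  split.
  - by rewrite /F setDT.
  - by move=> A B FA FB; rewrite /F setDIr; exact: PU.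
  - by move=> A B AB; apply: mono => x [Kx nB]; split => // /AB.
have FK : F K by rewrite /F setDv.
have [x [Kx cx]] := cK F FF FK.
have [e e0 Pe] := loc x Kx.
have FnB : F (~` [set y | nr (x - y) < e]).
  by rewrite /F; apply: mono Pe => y [Ky]; rewrite /= => /contrapT.
have nB : nbhs x [set y | nr (x - y) < e] by apply/nbhs_nr; exists e.
by have [y [/= ny yy]] := cx _ _ FnB nB; exact: ny.
Qed.

Lemma compact_net (K : set V) (e : R) : compact K -> 0 < e ->
  exists n (k : 'I_n -> V), (forall i, K (k i)) /\
    forall x, K x -> exists i, nr (x - k i) < e.
Proof.
move=> cK e0; apply: (compact_ind (P := fun S => exists n (k : 'I_n -> V),
  (forall i, K (k i)) /\ forall x, S x -> exists i, nr (x - k i) < e)) => //.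
- move=> S T ST [n [k [Kk h]]]; exists n, k; split => // x /ST; exact: h.
- by exists 0%N, (fun=> 0); split => // -[].
- move=> S T [n [k [Kk h]]] [n' [k' [Kk' h']]].
  exists (n + n')%N, (fun i => match fintype.split i with inl j => k j | inr j => k' j end).
  split; first by move=> i; case: fintype.split.
  move=> x [/h|/h'] [i hi].
    by exists (lshift n' i); rewrite (unsplitK (inl _ i)).
  by exists (rshift n i); rewrite (unsplitK (inr _ i)).
- move=> x Kx; exists e => //; exists 1%N, (fun=> x); split => // y [Ky xy].
  by exists ord0; rewrite nrB.
Qed.

Lemma compact_nr_bounded (K : set V) : compact K ->
  exists2 M, 0 <= M & forall x, K x -> nr x <= M.
Proof.
move=> cK; have [n [k [_ h]]] := compact_net cK (ltr01 : 0 < (1 : R)).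
exists (\sum_i nr (k i) + 1).
  by rewrite addr_ge0 // sumr_ge0 // => i _; exact: nr_ge0.
move=> x /h [i hi]; rewrite (bigD1 i) //=.
have : 0 <= \sum_(j < n | j != i) nr (k j) by rewrite sumr_ge0 // => j _; exact: nr_ge0.
have := nrD (x - k i) (k i); rewrite subrK; lra.
Qed.

End Vec.

(** Completeness without sequences: read [W e v] as [v] approximating an ideal object with error
    [e]. The filter of approximations of small error is Cauchy, and its limit inherits the error of
    every single approximation. *)
Lemma complete_approx (V : completeNormedModType C) (W : R -> V -> Prop) :
  (forall e, 0 < e -> exists v, W e v) ->
  (forall e d v w, W e v -> W d w -> nr (v - w) <= e + d) ->
  exists l, forall e v, W e v -> nr (l - v) <= e.
Proof.
move=> ex co.
pose F : set_system V := fun B => exists2 e : R, 0 < e &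
  forall d v, d <= e -> W d v -> B v.
have FF : ProperFilter F.
  apply: Build_ProperFilter.
    by move=> [e e0 h]; have [v Wv] := ex e e0; exact: (h e v).
  split.
  - by exists 1.
  - move=> A B [e e0 h] [d d0 k]; exists (Num.min e d); first by rewrite lt_min e0.
    by move=> c v; rewrite le_min => /andP[ce cd] Wv; split; [exact: (h c)|exact: (k c)].
  - move=> A B AB [e e0 h]; exists e => // d v de /(h _ _ de); exact: AB.
have Fc : cauchy F.
  apply: cauchy_exP => e /gt0_complex[e0 ->].
  have [|v Wv] := ex (complex.Re e / 3); first by rewrite divr_gt0.
  exists v, (complex.Re e / 3); first by rewrite divr_gt0.
  move=> d w de Wd; rewrite ball_nr; have := co _ _ _ _ Wv Wd; lra.
have /cvg_ex[/= l Fl] := @cauchy_cvg V F FF Fc.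
exists l => e v We; apply: (ler_eps (k := 2)) => // d d0 _.
have [|c c0 h] := Fl [set y | nr (l - y) < d].
  by apply/nbhs_nr; exists d.
have m0 : 0 < Num.min c d by rewrite lt_min c0.
have [w Ww] := ex _ m0.
have := h (Num.min c d) w; rewrite ge_min lexx => /(_ isT Ww) /= lw.
have := co _ _ _ _ Ww We; have := nr_tri l w v.
have : Num.min c d <= d by rewrite ge_min lexx orbT.
lra.
Qed.

(** The supremum of the lower ends [v - e] works, because compatibility makes every [v + e] an upper
    bound of them. *)
Lemma real_approx (W : R -> R -> Prop) :
  (forall e, 0 < e -> exists v, W e v) ->
  (forall e d v w, W e v -> W d w -> `|v - w| <= e + d) ->
  exists l, forall e v, W e v -> `|l - v| <= e.
Proof.
move=> ex co.
pose S : set R := [set z | exists e v, W e v /\ z = v - e].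
have ub e v : W e v -> ubound S (v + e).
  move=> We z [d [w [Wd ->]]]; have := co _ _ _ _ We Wd.
  by rewrite ler_norml => /andP[]; lra.
have [v Wv] := ex 1 ltr01.
have S0 : S (v - 1) by exists 1, v.
have hS : has_sup S by split; [exists (v - 1)|exists (v + 1); exact: ub].
exists (sup S) => e w We.
have h1 : w - e <= sup S by apply: (ub_le_sup hS.2); exists e, w.
have h2 : sup S <= w + e by apply: ge_sup; [exists (v - 1)|exact: ub].
by rewrite ler_norml; apply/andP; split; lra.
Qed.

Lemma complex_approx (W : R -> C -> Prop) :
  (forall e, 0 < e -> exists v, W e v) ->
  (forall e d v w, W e v -> W d w -> normc (v - w) <= e + d) ->
  exists l, forall e v, W e v -> normc (l - v) <= e.
Proof.
move=> ex co.
have [||a ha] := @real_approx (fun e x => exists2 v, W e v & x = complex.Re v).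
- by move=> e /ex[v Wv]; exists (complex.Re v), v.
- move=> e d _ _ [v We ->] [w Wd ->].
  apply: le_trans (co _ _ _ _ We Wd); apply: le_trans (normc_ge_Re _).
  by case: (v) (w) => ? ? [].
have [||b hb] := @real_approx (fun e x => exists2 v, W e v & x = complex.Im v).
- by move=> e /ex[v Wv]; exists (complex.Im v), v.
- move=> e d _ _ [v We ->] [w Wd ->].
  apply: le_trans (co _ _ _ _ We Wd); apply: le_trans (normc_ge_Im _).
  by case: (v) (w) => ? ? [].
(* Coordinates alone would double the error. Passing through a finer approximation [w] of error [d]
   costs [3 * d] in total and restores the sharp bound [e]. *)
exists (a +i* b)%C => e v We; apply: (ler_eps (k := 3)) => // d d0 _.
have [w Wd] := ex d d0.
have : normc ((a +i* b)%C - w) <= d + d.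
  apply: le_trans (normc_le_ReIm _) _; apply: lerD.
    by apply: le_trans (ha _ _ (ex_intro2 _ _ w Wd erefl)); case: (w).
  by apply: le_trans (hb _ _ (ex_intro2 _ _ w Wd erefl)); case: (w).
have := normc_tri (a +i* b)%C w v; have := co _ _ _ _ Wd We; lra.
Qed.

End RealNorm.

(** * Polynomial expressions and the joint spectrum *)

Lemma expr_small (R : realType) (r e : R) : 0 <= r -> r < 1 -> 0 < e ->
  exists n, r ^+ n <= e.
Proof.
move=> r0 r1 e0; have /cvgrPdist_lt /(_ e e0) : (fun n => r ^+ n) @ \oo --> (0 : R).
  by apply: cvg_expr; rewrite ger0_norm.
move=> [n _ /(_ n (leqnn n))]; rewrite sub0r normrN ger0_norm ?exprn_ge0 // => h.
by exists n; exact: ltW.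
Qed.

(** * Neumann series and automatic continuity of characters *)

Section Algebra.
Variables (R : realType) (A : BanachAlg R).
Local Notation C := R[i].
Local Notation "1b" := (ba_one A).
Local Notation "a ** b" := (@ba_mul R A a b) (at level 40, left associativity).

Lemma ba_mulDr (a b c : A) : a ** (b + c) = a ** b + a ** c.
Proof. by rewrite ba_mulC ba_mulDl !(ba_mulC _ a). Qed.

Lemma ba_mulZr (k : C) (a b : A) : a ** (k *: b) = k *: (a ** b).
Proof. by rewrite ba_mulC ba_mulZl ba_mulC. Qed.

Lemma ba_mul0l (a : A) : 0 ** a = 0.
Proof. by have := @ba_mulZl R A 0 0 a; rewrite !scale0r. Qed.

Lemma ba_mulNl (a b : A) : (- a) ** b = - (a ** b).
Proof. by rewrite -scaleN1r ba_mulZl scaleN1r. Qed.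

Lemma ba_mulBl (a b c : A) : (a - b) ** c = a ** c - b ** c.
Proof. by rewrite ba_mulDl ba_mulNl. Qed.

Lemma ba_mulBr (a b c : A) : a ** (b - c) = a ** b - a ** c.
Proof. by rewrite ba_mulC ba_mulBl !(ba_mulC _ a). Qed.

Lemma ba_mulr1 (a : A) : a ** 1b = a.
Proof. by rewrite ba_mulC ba_mul1. Qed.

Lemma nr_mul (a b : A) : nr (a ** b) <= nr a * nr b.
Proof. by rewrite -lecR rmorphM /= -!nrE ba_norm_mul. Qed.

Lemma neumann (b : A) : nr b < 1 -> exists d, d ** (1b - b) = 1b.
Proof.
move=> b1; set r := nr b; have r0 : 0 <= r by exact: nr_ge0.
pose pw n := iter n (ba_mul b) 1b.
pose S n := \sum_(i < n) pw i.
(* Tail of the geometric series that majorises the powers of [b]; the factor [nr 1b] appears because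
   the norm of the unit is not fixed to be 1. *)
pose t n := nr 1b * r ^+ n / (1 - r).
have r1 : 0 < 1 - r by lra.
have n1 : 0 <= nr 1b by exact: nr_ge0.
have pwE n : nr (pw n) <= nr 1b * r ^+ n.
  elim: n => [|n IH]; first by rewrite expr0 mulr1.
  apply: le_trans (nr_mul _ _) _; rewrite exprS mulrCA.
  exact: ler_wpM2l.
have SE n : S n ** (1b - b) = 1b - pw n.
  elim: n => [|n IH]; first by rewrite /S big_ord0 ba_mul0l subrr.
  rewrite /S big_ord_recr /= ba_mulDl -/(S n) IH ba_mulBr ba_mulr1 (ba_mulC _ b).
  by rewrite addrA subrK.
have tS n : t n - t n.+1 = nr 1b * r ^+ n.
  rewrite /t exprS -mulrBl -mulrBr -[X in X - _]mul1r -mulrBl.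
  by rewrite (mulrC (1 - r)) mulrA mulfK // lt0r_neq0.
have Sd m n : nr (S (n + m)%N - S n) <= t n - t (n + m)%N.
  elim: m => [|m IH]; first by rewrite addn0 !subrr nr0.
  rewrite addnS; have := tS (n + m)%N; have := pwE (n + m)%N.
  rewrite {1}/S big_ord_recr /= -/(S _) addrAC.
  have := nrD (S (n + m)%N - S n) (pw (n + m)%N); lra.
have t0 n : 0 <= t n by rewrite /t divr_ge0 ?mulr_ge0 ?exprn_ge0 // ltW.
have ts e : 0 < e -> exists n, t n <= e.
  move=> e0; have [|n hn] := @expr_small _ r (e * (1 - r) / (nr 1b + 1)) r0 b1.
    by rewrite divr_gt0 ?mulr_gt0 //; lra.
  exists n; rewrite /t ler_pdivrMr //.
  have : r ^+ n * (nr 1b + 1) <= e * (1 - r) by rewrite -ler_pdivlMr //; lra.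
  have : 0 <= r ^+ n by exact: exprn_ge0.
  nra.
have [||d dE] := @complete_approx _ A (fun e v => exists2 n, t n <= e & v = S n).
- by move=> e /ts[n tn]; exists (S n), n.
- move=> e e' _ _ [n tn ->] [m tm ->].
  case: (leqP n m) => nm.
    have := Sd (m - n)%N n; rewrite subnKC // nrB.
    have := t0 m; have := t0 n; lra.
  have := Sd (n - m)%N m; rewrite subnKC ?(ltnW nm) //.
  have := t0 m; have := t0 n; lra.
exists d; apply/eqP; rewrite -subr_eq0; apply/eqP; apply: nr_eq0.
apply: (ler_eps (k := nr (1b - b) + 1)); first by rewrite addr_ge0 ?nr_ge0.
move=> e e0 _; rewrite add0r; have [n tn] := ts e e0.
(* The first term is controlled by the distance from [d] to a partial sum, the second by
   [t n - t n.+1], hence by [e]. *)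
have -> : d ** (1b - b) - 1b = (d - S n) ** (1b - b) - pw n.
  by rewrite ba_mulBl SE opprB addrA addrAC addrK.
have h1 := nrD ((d - S n) ** (1b - b)) (- pw n).
have h2 : nr (d - S n) <= e by apply: dE; exists n.
have h3 := nr_mul (d - S n) (1b - b).
have h4 := pwE n; rewrite nrN in h1.
have h5 : nr (d - S n) * nr (1b - b) <= e * nr (1b - b).
  by apply: ler_wpM2r => //; exact: nr_ge0.
have h6 := tS n; have h7 := t0 n.+1; lra.
Qed.

(** The definition of a character does not mention continuity; here it comes for free. Were [chi a]
    larger than [nr a] in modulus, [1b - (chi a)^-1 *: a] would be invertible by its Neumann series,
    yet [chi] kills it. *)
Lemma character_contraction (chi : A -> C) (a : A) :
  is_character chi -> normc (chi a) <= nr a.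
Proof.
move=> [lin [mul one]]; rewrite leNgt; apply/negP => h.
have c0 : chi a != 0.
  by rewrite -normc_eq0 lt0r_neq0 // (le_lt_trans _ h) ?nr_ge0.
have lt1 : nr ((chi a)^-1 *: a) < 1.
  by rewrite nrZ normcV mulrC ltr_pdivrMr ?mul1r // (le_lt_trans _ h) ?nr_ge0.
have [d dE] := neumann lt1.
have chi0 : chi 0 = 0.
  have := lin (-1) 0 0; rewrite scaler0 addr0 mulN1r addrC.
  by rewrite subrr.
have : chi (1b - (chi a)^-1 *: a) = 0.
  rewrite addrC -scaleNr lin one mulNr mulVf // addrC subrr //.
move=> e; have := mul d (1b - (chi a)^-1 *: a).
by rewrite dE e one mulr0 => /eqP; rewrite oner_eq0.
Qed.

End Algebra.

(** Polynomial expressions are kept as syntax because the same expression is evaluated at a point of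
    [E], at a function on the dual ball and in an algebra. The last two values are not determined a
    priori by the polynomial function on [E]. *)
Inductive term (R : realType) (E : Type) :=
| TOne | TVar of (E -> R[i])
| TAdd of term R E & term R E
| TScale of R[i] & term R E
| TMul of term R E & term R E.
Arguments TOne {R E}.

Section Terms.
Variables (R : realType) (E : completeNormedModType R[i]).
Local Notation C := R[i].
Local Notation term := (term R E).
Implicit Types t : term.

Fixpoint wf t : Prop := match t with
  | TOne => True
  | TVar phi => in_dual_ball phi
  | TAdd t u => wf t /\ wf u
  | TScale _ t => wf t
  | TMul t u => wf t /\ wf u
  end.

Fixpoint evC (lambda : (E -> C) -> C) t : C := match t with
  | TOne => 1
  | TVar phi => lambda phi
  | TAdd t u => evC lambda t + evC lambda u
  | TScale k t => k * evC lambda t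
  | TMul t u => evC lambda t * evC lambda u
  end.

Definition evE (x : E) t : C := evC (fun phi => phi x) t.

Fixpoint evA (A : BanachAlg R) (f : (E -> C) -> A) t : A := match t with
  | TOne => ba_one A
  | TVar phi => f phi
  | TAdd t u => evA f t + evA f u
  | TScale k t => k *: evA f t
  | TMul t u => ba_mul (evA f t) (evA f u)
  end.

Lemma eq_evC (l m : (E -> C) -> C) t : wf t ->
  (forall phi, in_dual_ball phi -> l phi = m phi) -> evC l t = evC m t.
Proof.
move=> + h; elim: t => //= [t IHt u IHu [/IHt -> /IHu -> //]|k t IH /IH -> //|
  t IHt u IHu [/IHt -> /IHu -> //]].
Qed.

Lemma in_dual_ballP (phi : E -> C) :
  in_dual_ball phi <-> in_dual phi /\ forall x, normc (phi x) <= nr x.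
Proof. by split=> -[d h]; split=> // x; have := h x; rewrite abs_normcE nrE lecR. Qed.

Lemma linear_subr (phi : E -> C) x y : clinear_fun phi -> phi (x - y) = phi x - phi y.
Proof. by move=> lin; rewrite addrC -scaleN1r lin mulN1r addrC. Qed.

Lemma linear_zero (phi : E -> C) : clinear_fun phi -> phi 0 = 0.
Proof. by move=> lin; rewrite -(subrr 0) linear_subr // subrr. Qed.

Lemma linear_scale (phi : E -> C) a x : clinear_fun phi -> phi (a *: x) = a * phi x.
Proof. by move=> lin; rewrite -[a *: x]addr0 lin linear_zero // addr0. Qed.

Lemma in_dual_bounded (phi : E -> C) : in_dual phi <->
  clinear_fun phi /\ exists2 M, 0 <= M & forall x, normc (phi x) <= M * nr x.
Proof.
split => -[lin h]; split => //.
  have := h 0 => /= h0.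
  have /nbhs_nr[d d0 hd] : nbhs (0 : E) (phi @^-1` [set z : C | normc (z - 0) < 1]).
    apply: h0; apply/(@nbhs_nr R C^o); exists 1 => // z /=.
    rewrite linear_zero // => zz; rewrite normcB.
    by rewrite -ltcR -abs_normcE; move: zz; rewrite -nr_le_lt.
  exists (2 / d); first by rewrite divr_ge0 // ltW.
  move=> x; have [x0|x0] := eqVneq (nr x) 0.
    by rewrite (nr_eq0 (x := x)) ?x0 // linear_zero // normc0 nr0 mulr0.
  have xp : 0 < nr x by rewrite lt_def x0 nr_ge0.
  have kp : 0 < d / 2 / nr x by rewrite !divr_gt0.
  have := hd (((d / 2 / nr x)%:C)%C *: x).
  rewrite sub0r nrN nrZ normc_real gtr0_norm // divfK // => /(_ ltac:(lra)) /=.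
  rewrite subr0 linear_scale // normcM normc_real gtr0_norm // => hh.
  have d2 : 0 < d / 2 by rewrite divr_gt0.
  rewrite -(ler_pM2l d2) mulrA.
  have -> : d / 2 * (2 / d) = 1 by field; exact: lt0r_neq0.
  rewrite mul1r.
  have -> : d / 2 * normc (phi x) = (d / 2 / nr x * normc (phi x)) * nr x.
    by rewrite [RHS]mulrAC divfK.
  by rewrite -[leRHS]mul1r ler_wpM2r ?nr_ge0 // ltW.
move=> x; case: h => M M0 hM.
move=> B /(@nbhs_nr R C^o)[e e0 h]; apply/nbhs_nr.
exists (e / (M + 1)); first by rewrite divr_gt0 //; lra.
move=> y; rewrite ltr_pdivlMr; last by lra.
move=> xy; apply: h; rewrite -nr_le_lt abs_normcE ltcR -linear_subr //.
apply: le_lt_trans (hM _) _; apply: le_lt_trans xy.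
rewrite mulrC ler_wpM2l ?nr_ge0 //; lra.
Qed.

Lemma in_dual_ball_of_bounded (phi : E -> C) : clinear_fun phi ->
  (forall x, normc (phi x) <= nr x) -> in_dual_ball phi.
Proof.
move=> lin h; apply/in_dual_ballP; split => //.
by apply/in_dual_bounded; split => //; exists 1 => // x; rewrite mul1r.
Qed.

Lemma in_dual_scale (a : C) (phi : E -> C) : in_dual phi ->
  @in_dual R E (fun x => a * phi x).
Proof.
move=> /in_dual_bounded[lin [M M0 h]]; apply/in_dual_bounded; split.
  by move=> k x y; rewrite lin; ring.
exists (normc a * M); first by rewrite mulr_ge0 ?normc_ge0.
by move=> x; rewrite normcM -mulrA ler_wpM2l ?normc_ge0.
Qed.

(** The product rule for Lipschitz constants needs bounds on both factors, so the bound and the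
    constant go through one induction. *)
Lemma evE_lipschitz t (M : R) : wf t -> 0 <= M ->
  exists B L, [/\ 0 <= B, 0 <= L & forall x y, nr x <= M -> nr y <= M ->
    normc (evE x t) <= B /\ normc (evE x t - evE y t) <= L * nr (x - y)].
Proof.
move=> + M0; elim: t => [|phi|t IHt u IHu|k t IH|t IHt u IHu].
- move=> _; exists 1, 0; split => // x y _ _.
  by rewrite /evE [evC _ _]/(1 : C) subrr normc0 mul0r normc1.
- move=> /in_dual_ballP[[lin _] h]; exists M, 1; split => // x y xM yM.
  rewrite /evE /= mul1r -linear_subr //; split; last exact: h.
  exact: le_trans (h _) xM.
- move=> [/IHt[B [L [B0 L0 h]]] /IHu[B' [L' [B0' L0' h']]]].
  exists (B + B'), (L + L'); split; try by rewrite addr_ge0.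
  move=> x y xM yM; have [h1 h2] := h x y xM yM; have [h3 h4] := h' x y xM yM.
  rewrite /evE /= -!/(evE _ _); split; first by apply: le_trans (normcD _ _) (lerD _ _).
  rewrite opprD addrACA mulrDl; by apply: le_trans (normcD _ _) (lerD _ _).
- move=> /IH[B [L [B0 L0 h]]]; exists (normc k * B), (normc k * L).
  split; try by rewrite mulr_ge0 ?normc_ge0.
  move=> x y xM yM; have [h1 h2] := h x y xM yM.
  rewrite /evE /= -!/(evE _ _) -mulrBr !normcM -mulrA.
  by split; rewrite ler_wpM2l ?normc_ge0.
- move=> [/IHt[B [L [B0 L0 h]]] /IHu[B' [L' [B0' L0' h']]]].
  exists (B * B'), (B * L' + L * B'); split; try by rewrite ?addr_ge0 ?mulr_ge0.
  move=> x y xM yM; have [h1 h2] := h x y xM yM; have [h3 h4] := h' x y xM yM.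
  have [h5 _] := h' y x yM xM.
  rewrite /evE /= -!/(evE _ _); split; first by rewrite normcM ler_pM ?normc_ge0.
  have -> : evE x t * evE x u - evE y t * evE y u =
    evE x t * (evE x u - evE y u) + (evE x t - evE y t) * evE y u by ring.
  apply: le_trans (normcD _ _) _; rewrite !normcM.
  have -> : (B * L' + L * B') * nr (x - y) = B * (L' * nr (x - y)) + L * nr (x - y) * B'.
    by ring.
  by apply: lerD; rewrite ler_pM ?normc_ge0.
Qed.

Lemma evE_continuous t (x : E) (e : R) : wf t -> 0 < e ->
  exists2 d, 0 < d & forall y, nr (x - y) < d -> normc (evE x t - evE y t) < e.
Proof.
move=> wt e0; have M0 : 0 <= nr x + 1 by rewrite addr_ge0 ?nr_ge0.
have [B [L [_ L0 h]]] := evE_lipschitz wt M0.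
exists (Num.min 1 (e / (L + 1))).
  by rewrite lt_min ltr01 divr_gt0 //; lra.
move=> y; rewrite lt_min ltr_pdivlMr; last by lra.
move=> /andP[y1 y2].
have ny : nr y <= nr x + 1.
  by have := nrD (y - x) x; rewrite subrK nrB; lra.
have [|_ h2] := h x y _ ny; first by lra.
apply: le_lt_trans h2 _; apply: le_lt_trans y2.
rewrite mulrC ler_wpM2l ?nr_ge0 //; lra.
Qed.

(** * Polynomials of finite type against polynomial expressions *)

Section FiniteType.
Implicit Types P Q : E -> C.

(** With sequences in place of dependently typed families, a sum of polynomials is a concatenation
    and a product concatenates monomials pairwise. *)
Lemma finite_type_seq P : finite_type_poly P <->
  exists ss : seq (seq (E -> C)),
    (forall s phi, s \in ss -> phi \in s -> in_dual phi) /\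
    forall x, P x = \sum_(s <- ss) \prod_(phi <- s) phi x.
Proof.
split.
  move=> [m [n [phi [d h]]]].
  exists [seq [seq phi i j | j <- enum 'I_(n i)] | i <- enum 'I_m]; split.
    by move=> s psi /mapP[i _ ->] /mapP[j _ ->]; exact: d.
  move=> x; rewrite h big_map big_enum; apply: eq_bigr => i _.
  by rewrite big_map big_enum.
move=> [ss [d h]].
exists (size ss), (fun i => size (nth [::] ss i)),
  (fun i j => nth (fun=> 0) (nth [::] ss i) j); split.
  by move=> i j; apply: (d (nth [::] ss i)); rewrite mem_nth.
move=> x; rewrite h (big_nth [::]) big_mkord; apply: eq_bigr => i _.
by rewrite (big_nth (fun=> 0)) big_mkord.
Qed.

Lemma finite_type_eq P Q : P =1 Q -> finite_type_poly P -> finite_type_poly Q.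
Proof. by move=> /funext ->. Qed.

Lemma finite_type0 : @finite_type_poly R E (fun=> 0).
Proof. by apply/finite_type_seq; exists [::]; split => // x; rewrite big_nil. Qed.

Lemma finite_type1 : @finite_type_poly R E (fun=> 1).
Proof.
apply/finite_type_seq; exists [:: [::]]; split.
  by move=> s phi; rewrite inE => /eqP ->.
by move=> x; rewrite big_seq1 big_nil.
Qed.

Lemma finite_type_dual (phi : E -> C) : in_dual phi -> finite_type_poly phi.
Proof.
move=> d; apply/finite_type_seq; exists [:: [:: phi]]; split.
  by move=> s psi; rewrite inE => /eqP ->; rewrite inE => /eqP ->.
by move=> x; rewrite !big_seq1.
Qed.

Lemma finite_type_add P Q : finite_type_poly P -> finite_type_poly Q ->
  @finite_type_poly R E (fun x => P x + Q x).
Proof.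
move=> /finite_type_seq[ss [d h]] /finite_type_seq[ss' [d' h']].
apply/finite_type_seq; exists (ss ++ ss'); split.
  by move=> s phi; rewrite mem_cat => /orP[]; [exact: d|exact: d'].
by move=> x; rewrite big_cat /= h h'.
Qed.

Lemma finite_type_mul P Q : finite_type_poly P -> finite_type_poly Q ->
  @finite_type_poly R E (fun x => P x * Q x).
Proof.
move=> /finite_type_seq[ss [d h]] /finite_type_seq[ss' [d' h']].
apply/finite_type_seq; exists [seq s ++ s' | s <- ss, s' <- ss']; split.
  move=> s phi /allpairsP[[u v] /= [uss vss ->]]; rewrite mem_cat.
  by move=> /orP[]; [exact: d|exact: d'].
move=> x; rewrite big_allpairs_dep h h' mulr_suml; apply: eq_bigr => s _.
by rewrite mulr_sumr; apply: eq_bigr => s' _; rewrite big_cat.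
Qed.

(* A constant is of finite type only when it is a sum of empty products, i.e. a natural
   number; hence the constant term of a polynomial expression must be normalised. *)
Lemma finite_type_evE t : wf t ->
  exists2 s : C, s != 0 & @finite_type_poly R E (fun x => s * evE x t).
Proof.
(* [Z P] plays the role of a vanishing constant term: scalars can then be absorbed into a functional
   of each monomial. *)
move=> wt; pose Z P := forall a : C, @finite_type_poly R E (fun x => a * P x).
have ZF P : Z P -> finite_type_poly P.
  by move=> /(_ 1); apply: finite_type_eq => x; rewrite mul1r.
have Z0 : Z (fun=> 0 : C).
  by move=> a; apply: finite_type_eq finite_type0 => x; rewrite mulr0.
have ZD P Q : Z P -> Z Q -> Z (fun x => P x + Q x).
  move=> ZP ZQ a; apply: finite_type_eq (finite_type_add (ZP a) (ZQ a)) => x.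
  by rewrite mulrDr.
have ZZ P k : Z P -> Z (fun x => k * P x).
  by move=> ZP a; apply: finite_type_eq (ZP (a * k)) => x; rewrite mulrA.
have ZM P Q : Z P -> Z Q -> Z (fun x => P x * Q x).
  move=> ZP /ZF FQ a; apply: finite_type_eq (finite_type_mul (ZP a) FQ) => x.
  by rewrite mulrA.
have [c [P ZP h]] : exists c, exists2 P, Z P & forall x, evE x t = c + P x.
  elim: t wt => [|phi|t IHt u IHu|k t IH|t IHt u IHu].
  - by move=> _; exists 1, (fun=> 0) => // x; rewrite addr0.
  - move=> [d _]; exists 0, phi => [a|x]; last by rewrite add0r.
    by apply: finite_type_dual; exact: in_dual_scale.
  - move=> [/IHt[c [P ZP h]] /IHu[c' [P' ZP' h']]].
    exists (c + c'), (fun x => P x + P' x); first exact: ZD.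
    by move=> x; rewrite /evE /= -!/(evE _ _) h h'; ring.
  - move=> /IH[c [P ZP h]]; exists (k * c), (fun x => k * P x); first exact: ZZ.
    by move=> x; rewrite /evE /= -!/(evE _ _) h; ring.
  - move=> [/IHt[c [P ZP h]] /IHu[c' [P' ZP' h']]].
    exists (c * c'), (fun x => (c * P' x + c' * P x) + P x * P' x).
      by apply: (ZD _ _ _ (ZM _ _ _ _)) => //; apply: ZD; exact: ZZ.
    by move=> x; rewrite /evE /= -!/(evE _ _) h h'; ring.
have [c0|c0] := eqVneq c 0.
  exists 1; first exact: oner_neq0.
  by apply: finite_type_eq (ZF _ ZP) => x; rewrite h c0 add0r mul1r.
exists c^-1; first by rewrite invr_eq0.
apply: finite_type_eq (finite_type_add finite_type1 (ZP c^-1)) => x.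
by rewrite h mulrDr mulVf.
Qed.

Lemma finite_type_term P : finite_type_poly P ->
  exists2 t, wf t & forall x, P x = evE x t.
Proof.
have dualt phi : in_dual phi -> exists2 t, wf t & forall x, phi x = evE x t.
  move=> d; have [lin [M M0 h]] := (in_dual_bounded phi).1 d.
  have M1 : 0 < M + 1 by lra.
  have Mc : ((M + 1)%:C)%C != 0 :> C by rewrite -normc_eq0 normc_real normr_eq0 lt0r_neq0.
  (* Dividing by [M + 1], which is positive even for [M = 0], moves the functional into the dual
     ball. *)
  exists (TScale ((M + 1)%:C)%C (TVar (fun x => ((M + 1)%:C)%C^-1 * phi x))).
    apply: in_dual_ball_of_bounded; first by case: (in_dual_scale ((M + 1)%:C)%C^-1 d).
    move=> x; rewrite normcM normcV normc_real gtr0_norm // mulrC ler_pdivrMr //.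
    by apply: le_trans (h x) _; rewrite mulrC ler_wpM2l ?nr_ge0 //; lra.
  by move=> x; rewrite /evE /= mulrA mulfV // mul1r.
move=> /finite_type_seq[ss [d h]].
suff [t wt tE] : exists2 t, wf t &
    forall x, \sum_(s <- ss) \prod_(phi <- s) phi x = evE x t.
  by exists t => // x; rewrite h.
elim: ss d {h} => [|s ss IH] d.
  by exists (TScale 0 TOne) => // x; rewrite big_nil /evE /= mul0r.
have [|t wt tE] := IH.
  by move=> u phi us; apply: d; rewrite inE us orbT.
have [u wu uE] : exists2 u, wf u & forall x, \prod_(phi <- s) phi x = evE x u.
  have {}d phi : phi \in s -> in_dual phi by apply: d; rewrite inE eqxx.
  elim: s d => [|phi s IHs] d; first by exists TOne => // x; rewrite big_nil.
  have [|u wu uE] := IHs; first by move=> psi ps; apply: d; rewrite inE ps orbT.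
  have [|v wv vE] := dualt phi; first by apply: d; rewrite inE eqxx.
  by exists (TMul v u) => // x; rewrite big_cons vE uE.
by exists (TAdd u t) => // x; rewrite big_cons tE uE.
Qed.

End FiniteType.

(** * The ideal attached to a function on the dual ball *)

Section Spectrum.
Variables (A : BanachAlg R) (f : (E -> C) -> A).

Lemma alg_gen_term (a : A) : alg_gen (f @` in_dual_ball (E:=E)) a <->
  exists2 t, wf t & a = evA f t.
Proof.
split.
  move=> /(_ [set a | exists2 t, wf t & a = evA f t]); apply.
  - by exists TOne.
  - by move=> _ [phi b <-]; exists (TVar phi).
  - by move=> _ _ [t wt ->] [u wu ->]; exists (TAdd t u).
  - by move=> k _ [t wt ->]; exists (TScale k t).
  - by move=> _ _ [t wt ->] [u wu ->]; exists (TMul t u).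
move=> [t + ->] T T1 TS TD TZ TM.
elim: t => //= [phi b|t IHt u IHu [/IHt Tt /IHu Tu]|k t IH /IH|
  t IHt u IHu [/IHt Tt /IHu Tu]].
- by apply: TS; exists phi.
- exact: TD.
- exact: TZ.
- exact: TM.
Qed.

Lemma generates_approx : generates (f @` in_dual_ball (E:=E)) ->
  forall (a : A) (e : R), 0 < e -> exists2 t, wf t & nr (a - evA f t) < e.
Proof.
move=> g a e e0; have : closure (alg_gen (f @` in_dual_ball (E:=E))) a by rewrite g.
move=> /(_ [set b | nr (a - b) < e]) []; first by apply/nbhs_nr; exists e.
by move=> _ [/alg_gen_term[t wt ->]]; exists t.
Qed.

Variable lambda : (E -> C) -> C.
Local Notation "a ** b" := (@ba_mul R A a b) (at level 40, left associativity).

(** The ideal whose properness defines the joint spectrum, presented inductively so that its closure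
    properties follow by induction instead of by manipulating indexed sums. *)
Inductive spec_ideal : A -> Prop :=
| spec_ideal0 : spec_ideal 0
| spec_idealS a phi b : in_dual_ball phi -> spec_ideal b ->
    spec_ideal (a ** (lambda phi *: ba_one A - f phi) + b).

Lemma in_joint_spectrumP : in_joint_spectrum f lambda <-> ~ spec_ideal (ba_one A).
Proof.
apply: not_iff_compat; split.
  move=> [n [a [phi [d ->]]]]; elim: n a phi d => [|n IH] a phi d.
    by rewrite big_ord0; exact: spec_ideal0.
  rewrite big_ord_recl; apply: spec_idealS => //.
  by apply: (IH (fun i => a (lift ord0 i)) (fun i => phi (lift ord0 i))).
suff H c : spec_ideal c -> exists n (a : 'I_n -> A) (phi : 'I_n -> E -> C),
    (forall i, in_dual_ball (phi i)) /\
    c = \sum_(i < n) a i ** (lambda (phi i) *: ba_one A - f (phi i)) by exact: H.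
elim.
  by exists 0%N, (fun=> 0), (fun=> fun=> 0); split => [[]//|]; rewrite big_ord0.
move=> a phi b d _ [n [a' [phi' [d' ->]]]].
exists n.+1, (fun i => oapp a' a (unlift ord0 i)),
  (fun i => oapp phi' phi (unlift ord0 i)); split.
  by move=> i; case: (unlift ord0 i).
rewrite big_ord_recl unlift_none /=; congr (_ + _).
by apply: eq_bigr => i _; rewrite liftK.
Qed.

Lemma spec_ideal_gen phi : in_dual_ball phi ->
  spec_ideal (lambda phi *: ba_one A - f phi).
Proof.
by move=> d; have := spec_idealS (ba_one A) d spec_ideal0; rewrite addr0 ba_mul1.
Qed.

Lemma spec_ideal_add a b : spec_ideal a -> spec_ideal b -> spec_ideal (a + b).
Proof.
move=> ha hb; elim: ha => [|c phi d dphi _ h]; first by rewrite add0r.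
by rewrite -addrA; exact: spec_idealS.
Qed.

Lemma spec_ideal_mul a b : spec_ideal b -> spec_ideal (a ** b).
Proof.
elim => [|c phi d dphi _ h]; first by rewrite ba_mulC ba_mul0l; exact: spec_ideal0.
by rewrite ba_mulDr ba_mulA; exact: spec_idealS.
Qed.

Lemma spec_ideal_scale (k : C) b : spec_ideal b -> spec_ideal (k *: b).
Proof. by move=> /(spec_ideal_mul (k *: ba_one A)); rewrite ba_mulZl ba_mul1. Qed.

(** Modulo the ideal each [f phi] is the scalar [lambda phi], and both evaluations respect the
    algebra operations. *)
Lemma spec_ideal_term t : wf t -> spec_ideal (evC lambda t *: ba_one A - evA f t).
Proof.
elim: t => /= [_|phi|t IHt u IHu [/IHt ht /IHu hu]|k t IH /IH|
  t IHt u IHu [/IHt ht /IHu hu]].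
- by rewrite scale1r subrr; exact: spec_ideal0.
- exact: spec_ideal_gen.
- by rewrite scalerDl opprD addrACA; exact: spec_ideal_add.
- by rewrite -scalerA -scalerBr; exact: spec_ideal_scale.
- have -> : (evC lambda t * evC lambda u) *: ba_one A - evA f t ** evA f u =
    evC lambda t *: (evC lambda u *: ba_one A - evA f u) +
    evA f u ** (evC lambda t *: ba_one A - evA f t).
    rewrite scalerBr scalerA ba_mulBr ba_mulZr ba_mulr1 (ba_mulC (evA f u)).
    by rewrite addrA subrK.
  by apply: spec_ideal_add; [exact: spec_ideal_scale|exact: spec_ideal_mul].
Qed.

(* Otherwise 1 - evA f t / evC lambda t is invertible, by its Neumann series, and
   lies in the ideal. *)
Lemma spectrum_bound t : in_joint_spectrum f lambda -> wf t ->
  normc (evC lambda t) <= nr (evA f t).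
Proof.
move=> /in_joint_spectrumP n1 wt; rewrite leNgt; apply/negP => h; apply: n1.
have cp : 0 < normc (evC lambda t) by apply: le_lt_trans h; exact: nr_ge0.
have c0 : evC lambda t != 0 by rewrite -normc_eq0 lt0r_neq0.
have lt1 : nr ((evC lambda t)^-1 *: evA f t) < 1.
  by rewrite nrZ normcV mulrC ltr_pdivrMr ?mul1r.
have [d <-] := neumann lt1; apply: spec_ideal_mul.
have := spec_ideal_scale (evC lambda t)^-1 (spec_ideal_term wt).
by rewrite scalerBr scalerA mulVf // scale1r.
Qed.

End Spectrum.
End Terms.

(** * Separation of points by the dual ball *)

Section HahnBanach.
Variables (R : realType) (E : completeNormedModType R[i]).
Local Notation C := R[i].
Implicit Types (q p u : E -> R) (x y : E).

(** Homogeneity is asked as an inequality, which is easier to check for infima; equality follows by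
    applying it with [t^-1]. *)
Definition sublinear q := (forall x y, q (x + y) <= q x + q y) /\
  forall (t : R) x, 0 < t -> q ((t%:C)%C *: x) <= t * q x.

Lemma sublinearZ q t x : sublinear q -> 0 < t -> q ((t%:C)%C *: x) = t * q x.
Proof.
move=> [_ h] t0; apply/eqP; rewrite eq_le h //=.
have ti : 0 < t^-1 by rewrite invr_gt0.
have := h t^-1 ((t%:C)%C *: x) ti; rewrite scalerA -rmorphM mulVf ?lt0r_neq0 //.
by rewrite scale1r ler_pdivlMl.
Qed.

Lemma sublinear_opp q x : sublinear q -> - q (- x) <= q x.
Proof.
move=> [h _]; have := h 0 0; rewrite addr0; have := h x (- x); rewrite subrr; lra.
Qed.

Lemma sublinear_nr : sublinear (@nr R E).
Proof.
split; first exact: nrD.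
by move=> t x t0; rewrite nrZ normc_real gtr0_norm.
Qed.

(* The tilt of q is a sublinear minorant of q.  A minimal q coincides with its tilts,
   and taking t = 1 shows that it is superadditive, hence linear. *)
Definition tilt_set q y x := [set z | exists2 t : R, 0 <= t & z = q (x + (t%:C)%C *: y) - t * q y].
Definition tilt q y x := inf (tilt_set q y x).

(** This makes the infimum finite: [t * q y = q (t y) <= q (x + t y) + q (- x)]. The case [t = 0] is
    separate, as homogeneity concerns positive scalars. *)
Lemma tilt_lbound q y x : sublinear q -> lbound (tilt_set q y x) (- q (- x)).
Proof.
move=> sq _ [t tge0 ->]; have [t0|t0] := ltrP 0 t; last first.
  have -> : t = 0 by lra.
  by rewrite mul0r subr0 scale0r addr0; exact: sublinear_opp.
rewrite -(sublinearZ _ sq t0); have := sq.1 (x + (t%:C)%C *: y) (- x).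
by rewrite addrAC subrr add0r; lra.
Qed.

Lemma tilt_le q y x t : sublinear q -> 0 <= t ->
  tilt q y x <= q (x + (t%:C)%C *: y) - t * q y.
Proof.
move=> sq t0; apply: ge_inf; first by exists (- q (- x)); exact: tilt_lbound.
by exists t.
Qed.

Lemma le_tilt q y x a :
  (forall t, 0 <= t -> a <= q (x + (t%:C)%C *: y) - t * q y) -> a <= tilt q y x.
Proof.
move=> h; apply: lb_le_inf; last by move=> _ [t t0 ->]; exact: h.
by exists (q (x + (0%:C)%C *: y) - 0 * q y), 0.
Qed.

(** Parameters [t] for [x] and [s] for [x'] combine to [t + s] for [x + x']; scaling by [t] turns
    the parameter [s] into [t * s]. *)
Lemma sublinear_tilt q y : sublinear q -> sublinear (tilt q y).
Proof.
move=> sq; split.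
  move=> x x'; rewrite -lerBlDr; apply: le_tilt => t t0.
  rewrite lerBlDr [leRHS]addrC -lerBlDr; apply: le_tilt => s s0.
  rewrite lerBlDr; apply: le_trans (tilt_le _ _ sq (addr_ge0 t0 s0)) _.
  have -> : x + x' + ((t + s)%:C)%C *: y = x + (t%:C)%C *: y + (x' + (s%:C)%C *: y).
    by rewrite rmorphD /= scalerDl addrACA.
  have := sq.1 (x + (t%:C)%C *: y) (x' + (s%:C)%C *: y); lra.
move=> t x t0; rewrite -ler_pdivrMl //; apply: le_tilt => s s0.
rewrite ler_pdivrMl //; have st0 : 0 <= t * s by rewrite mulr_ge0 // ltW.
apply: le_trans (tilt_le _ _ sq st0) _.
by rewrite rmorphM /= -scalerA -scalerDr (sublinearZ _ sq t0) -mulrA mulrBr.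
Qed.

Lemma tilt_le_self q y x : sublinear q -> tilt q y x <= q x.
Proof.
by move=> sq; have := tilt_le y x sq (lexx 0); rewrite scale0r addr0 mul0r subr0.
Qed.

(** Zorn's lemma for the reversed pointwise order. A chain has its pointwise infimum as lower bound,
    finite because every sublinear minorant of [p] is at least [- p (- x)] at [x]. *)
Lemma minimal_sublinear p : sublinear p -> exists u, [/\ sublinear u,
  forall x, u x <= p x & forall q, sublinear q -> (forall x, q x <= u x) ->
    forall x, u x <= q x].
Proof.
move=> sp; pose T := {q : E -> R | sublinear q /\ forall x, q x <= p x}.
pose Rel (q q' : T) := `[< forall x, sval q' x <= sval q x >].
have [] := @ZL_preorder T (exist _ p (conj sp (fun=> lexx _))) Rel.
- by move=> q; apply/asboolP.
- by move=> q r s /asboolP h /asboolP k; apply/asboolP => x; exact: le_trans (h x).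
- move=> A tot.
  (* Adjoining [p] keeps the family nonempty when the chain [A] is empty. *)
  pose S q := q = p \/ exists2 a : T, A a & q = sval a.
  have Ssub q : S q -> sublinear q /\ forall x, q x <= p x.
    by move=> [->|[[r [sr rp]] _ ->]].
  have Stot q q' : S q -> S q' ->
      (forall x, q x <= q' x) \/ (forall x, q' x <= q x).
    move=> Sq [->|[a Aa ->]]; first by left; case: (Ssub _ Sq).
    case: Sq => [->|[b Ab ->]]; first by right; case: (Ssub (sval a)) => //; right; exists a.
    by have [/asboolP|/asboolP] := tot _ _ Aa Ab; [left|right].
  pose m x := inf [set z | exists2 q, S q & z = q x].
  have m_le q x : S q -> m x <= q x.
    move=> Sq; apply: ge_inf; last by exists q.
    exists (- p (- x)) => _ [r /Ssub[sr rp] ->].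
    have := sublinear_opp x sr; have := rp (- x); lra.
  have le_m a x : (forall q, S q -> a <= q x) -> a <= m x.
    move=> h; apply: lb_le_inf; first by exists (p x), p => //; left.
    by move=> _ [q Sq ->]; exact: h.
  have sm : sublinear m.
    split.
      move=> x y; rewrite -lerBlDr; apply: (le_m) => q Sq.
      rewrite lerBlDr [leRHS]addrC -lerBlDr; apply: (le_m) => r Sr; rewrite lerBlDr.
      (* Subadditivity of the infimum: of two comparable members, the smaller one is used for both
         summands. *)
      have [h|h] := Stot _ _ Sq Sr.
        by have := m_le _ (x + y) Sq; have := (Ssub _ Sq).1.1 x y; have := h y; lra.
      by have := m_le _ (x + y) Sr; have := (Ssub _ Sr).1.1 x y; have := h x; lra.
    move=> t x t0; rewrite -ler_pdivrMl //; apply: (le_m) => q Sq.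
    rewrite ler_pdivrMl //; apply: le_trans (m_le _ _ Sq) _.
    exact: (Ssub _ Sq).1.2.
  have mp x : m x <= p x by apply: m_le; left.
  exists (exist _ m (conj sm mp)) => s As; apply/asboolP => x /=.
  by apply: m_le; right; exists s.
move=> [u [su up]] mu; exists u; split => // q sq qu.
have qp x : q x <= p x by exact: le_trans (qu x) (up x).
have /asboolP := mu (exist _ q (conj sq qp)) (introT (asboolP _) qu).
exact.
Qed.

(** Minimising below the tilt of the norm along [x0], and not below the norm itself, forces
    nonvanishing: the tilt is at most [- nr x0] at [- x0], so [u x0 >= nr x0]. *)
Lemma separate_from_zero x0 : x0 != 0 -> exists phi : E -> C,
  [/\ clinear_fun phi, forall x, normc (phi x) <= nr x & phi x0 != 0].
Proof.
move=> x00; have snr := sublinear_nr.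
have [u [su up umin]] := minimal_sublinear (sublinear_tilt x0 snr).
have uadd x y : u (x + y) = u x + u y.
  apply/eqP; rewrite eq_le su.1 /=.
  (* By minimality [u] lies below its own tilt, and the parameter 1 gives
     [u x <= u (x + y) - u y]. *)
  have := umin _ (sublinear_tilt y su) (fun z => tilt_le_self y z su) x.
  have := tilt_le y x su ler01; rewrite scale1r mul1r; lra.
have u0 : u 0 = 0 by have := uadd 0 0; rewrite addr0; lra.
have uN x : u (- x) = - u x by have := uadd x (- x); rewrite subrr u0; lra.
have uZ (t : R) x : u ((t%:C)%C *: x) = t * u x.
  have [t0|t0|->] := ltgtP t 0; last by rewrite scale0r mul0r.
    have tN : 0 < - t by lra.
    by have := sublinearZ x su tN; rewrite rmorphN /= scaleNr uN; lra.
  exact: sublinearZ.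
have unr x : u x <= nr x by exact: le_trans (up x) (tilt_le_self _ _ snr).
(* The complex-linear functional with real part [u]. *)
pose phi x : C := (u x +i* - u ('i *: x))%C.
have phiD x y : phi (x + y) = phi x + phi y.
  by rewrite /phi scalerDr !uadd; apply/eqP; rewrite eq_complex /= opprD !eqxx.
have phiR (t : R) x : phi ((t%:C)%C *: x) = (t%:C)%C * phi x.
  rewrite /phi scalerA mulrC -scalerA !uZ; apply/eqP; rewrite eq_complex /=.
  by apply/andP; split; apply/eqP; ring.
have phii x : phi ('i%C *: x) = 'i%C * phi x.
  rewrite /phi scalerA -expr2 sqr_i scaleN1r uN opprK; apply/eqP.
  by rewrite eq_complex /=; apply/andP; split; apply/eqP; ring.
have phiZ (a : C) x : phi (a *: x) = a * phi x.
  rewrite {1}(complexE a) scalerDl phiD phiR -scalerA phii phiR mulrA -mulrDl.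
  by rewrite -complexE.
exists phi; split.
- by move=> a x y; rewrite phiD phiZ.
- move=> x; have [->|z0] := eqVneq (phi x) 0; first by rewrite normc0 nr_ge0.
  have n0 : normc (phi x) != 0 by rewrite normc_eq0.
  (* The unimodular [c] rotates [phi x] to its modulus, so the real bound on [u] at [c *: x] bounds
     the modulus of [phi x]. *)
  pose c : C := ((normc (phi x))%:C)%C / phi x.
  have c1 : normc c = 1.
    by rewrite normcM normcV normc_real ger0_norm ?normc_ge0 // mulfV.
  have : phi (c *: x) = ((normc (phi x))%:C)%C by rewrite phiZ divfK.
  move=> /(congr1 (@complex.Re R)) /= <-.
  by apply: le_trans (unr _) _; rewrite nrZ c1 mul1r.
- apply/eqP => /(congr1 (@complex.Re R)) /= ux0.
  have := up (- x0); have := tilt_le x0 (- x0) snr ler01.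
  rewrite scale1r addNr nr0 mul1r uN ux0 => h1 h2.
  have : nr x0 <= 0 by lra.
  by move=> /nr_eq0 e; rewrite e eqxx in x00.
Qed.

End HahnBanach.

Lemma dual_ball_separates (R : realType) (E : completeNormedModType R[i]) (x y : E) :
  (forall phi, in_dual_ball phi -> phi x = phi y) -> x = y.
Proof.
move=> h; apply/eqP; rewrite -subr_eq0; apply: contraT => /separate_from_zero.
move=> [phi [lin b]]; rewrite linear_subr // h ?subrr ?eqxx //.
exact: in_dual_ball_of_bounded.
Qed.

(** * The character space of an algebra generated by f *)

Section FromAlgebra.
Variables (R : realType) (E : completeNormedModType R[i]) (K : set E).
Variables (A : BanachAlg R) (f : (E -> R[i]) -> A).
Local Notation C := R[i].
Implicit Types (x y : E) (t u : term R E).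
Hypotheses (genf : generates (f @` in_dual_ball (E:=E))) (specf : spectrum_is K f).

Lemma spectrum_point x : K x -> in_joint_spectrum f (fun phi => phi x).
Proof. by move=> Kx; apply/specf; exists x. Qed.

Lemma evE_le_evA x t : K x -> wf t -> normc (evE x t) <= nr (evA f t).
Proof. by move=> Kx; apply: spectrum_bound; exact: spectrum_point. Qed.

Lemma evE_sub x t u : evE x (TAdd t (TScale (-1) u)) = evE x t - evE x u.
Proof. by rewrite /evE /= mulN1r. Qed.

Lemma evA_sub t u : evA f (TAdd t (TScale (-1) u)) = evA f t - evA f u.
Proof. by rewrite /= scaleN1r. Qed.

(** Replacing the coefficients of an ideal element by polynomials in [f] changes it little, and each
    generator corresponds to [phi x - phi], which vanishes at [x]. *)
Lemma spec_ideal_approx x b : spec_ideal f (fun phi => phi x) b ->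
  forall e, 0 < e -> exists t, [/\ wf t, evE x t = 0 & nr (b - evA f t) < e].
Proof.
elim => [|a phi {}b dphi _ IH] e e0.
  exists (TScale 0 TOne); split => //; first by rewrite /evE /= mul0r.
  by rewrite /= scale0r subrr nr0.
have e2 : 0 < e / 2 by rewrite divr_gt0.
have [t [wt t0 ht]] := IH _ e2.
set g := _ - _; have g0 := nr_ge0 g.
have [|u wu hu] := generates_approx genf a (e := e / 2 / (nr g + 1)).
  by rewrite divr_gt0 //; lra.
exists (TAdd (TMul u (TAdd (TScale (phi x) TOne) (TScale (-1) (TVar phi)))) t).
split => //.
  by rewrite /evE /= -!/(evE _ _) t0 addr0 mulr1 mulN1r subrr mulr0.
rewrite /= scaleN1r -/g opprD addrACA -ba_mulBl.
apply: le_lt_trans (nrD _ _) _; rewrite [e]splitr.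
apply: ler_ltD ht; apply: le_trans (nr_mul _ _) _.
have : nr (a - evA f u) * (nr g + 1) <= e / 2 by rewrite -ler_pdivlMr ?ltW //; lra.
have := nr_ge0 (a - evA f u); lra.
Qed.

Lemma spectrum_poly_convex : poly_convex K.
Proof.
apply/seteqP; split => x.
  by move=> Kx P _; apply: ereal_sup_ubound; exists x.
move=> hx; suff : in_joint_spectrum f (fun phi => phi x).
  move=> /specf[y Ky h]; suff -> : x = y by [].
  exact: dual_ball_separates.
apply/in_joint_spectrumP => /spec_ideal_approx /(_ 1 ltr01)[t [wt t0 ht]].
(* [v = 1 - t] takes the value 1 at [x], while on [K] it is bounded by [nr (evA f v) < 1]. The
   factor [s] that makes it of finite type scales both sides equally. *)
pose v := TAdd TOne (TScale (-1) t).
have [|s s0 fs] := @finite_type_evE R E v; first by split.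
have := hx _ fs; apply/negP; rewrite -ltNge.
have vx : evE x v = 1 by rewrite evE_sub t0 subr0.
rewrite vx mulr1; apply: (@le_lt_trans _ _ (normc s * nr (evA f v))%:E).
  apply: ge_ereal_sup => _ [y Ky <-]; rewrite lee_fin normcM ler_wpM2l ?normc_ge0 //.
  by apply: evE_le_evA.
have sp : 0 < normc s by rewrite lt_def normc_eq0 s0 normc_ge0.
by rewrite lte_fin gtr_pMr // evA_sub.
Qed.

(** The continuous extension to [A] of the map sending a polynomial in [f] to its value at [x],
    pinned down by its distance to all such values. The default 0 is never taken for [x] in [K]. *)
Definition point_character (x : E) (a : A) : C :=
  xget 0 [set c | forall t, wf t -> normc (c - evE x t) <= nr (a - evA f t)].

(** Values at [x] of good approximants of [a] are compatible, since the spectral bound applies to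
    the difference of two expressions. *)
Lemma point_characterP x a t : K x -> wf t ->
  normc (point_character x a - evE x t) <= nr (a - evA f t).
Proof.
move=> Kx; suff [c hc] : exists c, forall t, wf t ->
    normc (c - evE x t) <= nr (a - evA f t).
  move=> wt; exact: (@xgetPex C 0 [set c | forall t, wf t ->
    normc (c - evE x t) <= nr (a - evA f t)] (ex_intro _ c hc) t wt).
have [||c hc] := @complex_approx R (fun e v =>
    exists t, [/\ wf t, nr (a - evA f t) <= e & v = evE x t]).
- move=> e /(generates_approx genf a)[u wu hu]; exists (evE x u), u.
  by split => //; exact: ltW.
- move=> e d _ _ [u [wu hu ->]] [v [wv hv ->]].
  rewrite -evE_sub; apply: le_trans (evE_le_evA Kx _) _; first by split.
  by rewrite evA_sub; have := nr_tri (evA f u) a (evA f v); rewrite (nrB (evA f u) a); lra.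
by exists c => u wu; apply: hc; exists u.
Qed.

(** The tool for computing the extension: an identity is proved by exhibiting approximants for which
    both [a] and the candidate value [c] have small error. *)
Lemma point_character_unique x a c : K x ->
  (forall e : R, 0 < e -> e <= 1 -> exists t, [/\ wf t, nr (a - evA f t) <= e
     & normc (c - evE x t) <= e]) ->
  point_character x a = c.
Proof.
move=> Kx h; apply/eqP; rewrite -subr_eq0 -normc_eq0 eq_le normc_ge0 andbT.
apply: (ler_eps (k := 2)) => // e e0 e1; have [t [wt h1 h2]] := h e e0 e1.
have := point_characterP a Kx wt.
have := normc_tri (point_character x a) (evE x t) c.
rewrite (normcB (evE x t)); lra.
Qed.

Lemma point_character_evA x t : K x -> wf t -> point_character x (evA f t) = evE x t.
Proof.
move=> Kx wt; apply: point_character_unique => // e e0 _; exists t.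
by rewrite !subrr nr0 normc0 ltW.
Qed.

Lemma point_character_is_character x : K x -> is_character (point_character x).
Proof.
move=> Kx; split; last split; last exact: (@point_character_evA _ TOne).
- move=> k a b; apply: point_character_unique => // e e0 _.
  have k0 := normc_ge0 k.
  pose d := e / (normc k + 1); have d0 : 0 < d by rewrite divr_gt0 //; lra.
  have dE : d * (normc k + 1) = e by rewrite divfK // lt0r_neq0 //; lra.
  have [t wt ht] := generates_approx genf a d0.
  have [u wu hu] := generates_approx genf b d0.
  exists (TAdd (TScale k t) u); split => //=.
    rewrite opprD addrACA -scalerBr; apply: le_trans (nrD _ _) _; rewrite nrZ; nra.
  rewrite /evE /= -!/(evE _ _) opprD addrACA -mulrBr; apply: le_trans (normcD _ _) _.
  rewrite normcM; have := point_characterP a Kx wt; have := point_characterP b Kx wu.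
  nra.
- move=> a b; apply: point_character_unique => // e e0 e1.
  have na := nr_ge0 a; have nb := nr_ge0 b.
  set ca := point_character x a; set cb := point_character x b.
  have nca := normc_ge0 ca; have ncb := normc_ge0 cb.
  (* [M] dominates the factors of both telescoped product differences; since [e <= 1 <= M], also
     [d <= 1], so the term quadratic in [d] is absorbed by the summand 1 of [M]. *)
  pose M := nr a + nr b + normc ca + normc cb + 1.
  have M1 : 1 <= M by rewrite /M; lra.
  pose d := e / M; have d0 : 0 < d by rewrite divr_gt0 //; lra.
  have dE : d * M = e by rewrite divfK // lt0r_neq0 //; lra.
  have d1 : d <= 1 by nra.
  have [t wt ht] := generates_approx genf a d0.
  have [u wu hu] := generates_approx genf b d0.
  exists (TMul t u); split => //=.
    have -> : ba_mul a b - ba_mul (evA f t) (evA f u) =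
        ba_mul (a - evA f t) b + ba_mul (evA f t) (b - evA f u).
      by rewrite ba_mulBl ba_mulBr addrA subrK.
    apply: le_trans (nrD _ _) _; apply: le_trans (lerD (nr_mul _ _) (nr_mul _ _)) _.
    have nt : nr (evA f t) <= nr a + d.
      by have := nrD (evA f t - a) a; rewrite subrK nrB; lra.
    have := nr_ge0 (a - evA f t); have := nr_ge0 (b - evA f u).
    have := nr_ge0 (evA f t); rewrite /M in dE; nra.
  have -> : ca * cb - evE x (TMul t u) = (ca - evE x t) * cb + evE x t * (cb - evE x u).
    by rewrite /evE /=; ring.
  apply: le_trans (normcD _ _) _; rewrite !normcM.
  have h1 := point_characterP a Kx wt; have h2 := point_characterP b Kx wu.
  have nt : normc (evE x t) <= normc ca + d.
    by have := normcD (evE x t - ca) ca; rewrite subrK normcB; lra.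
  have := normc_ge0 (ca - evE x t); have := normc_ge0 (cb - evE x u).
  have := normc_ge0 (evE x t); rewrite /M in dE; nra.
Qed.

Definition character_point (chi : A -> C) : E :=
  xget 0 [set x | K x /\ forall phi, in_dual_ball phi -> chi (f phi) = phi x].

(** The composite of [chi] with [f] lies in the joint spectrum, because [chi] kills the ideal
    attached to it but not the unit; the hypothesis on the spectrum then supplies the point. *)
Lemma character_pointP chi : is_character chi -> K (character_point chi) /\
  forall phi, in_dual_ball phi -> chi (f phi) = phi (character_point chi).
Proof.
move=> chiP; have [lin [mul one]] := chiP.
have chi0 : chi 0 = 0.
  by have := lin (-1) 0 0; rewrite scaler0 addr0 mulN1r addrC subrr.
have chiD a b : chi (a + b) = chi a + chi b.
  by have := lin 1 a b; rewrite scale1r mul1r.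
have chiZ k a : chi (k *: a) = k * chi a by have := lin k a 0; rewrite chi0 !addr0.
have : in_joint_spectrum f (fun phi => chi (f phi)).
  apply/in_joint_spectrumP => h.
  suff : chi (ba_one A) = 0 by rewrite one => /eqP; rewrite oner_eq0.
  elim: h => [//|a phi b _ _ IH].
  by rewrite chiD mul IH -scaleN1r chiD !chiZ one mulr1 mulN1r subrr mulr0 addr0.
move=> /specf[x Kx h]; exact: (@xgetPex E 0 [set x | K x /\
  forall phi, in_dual_ball phi -> chi (f phi) = phi x] (ex_intro _ x (conj Kx h))).
Qed.

Lemma character_evA chi t : is_character chi -> wf t ->
  chi (evA f t) = evE (character_point chi) t.
Proof.
move=> chiP; have [lin [mul one]] := chiP; have [_ h] := character_pointP chiP.
have chi0 : chi 0 = 0.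
  by have := lin (-1) 0 0; rewrite scaler0 addr0 mulN1r addrC subrr.
rewrite /evE; elim: t => //= [t IHt u IHu [/IHt <- /IHu <-]|k t IH /IH <-|
  t IHt u IHu [/IHt <- /IHu <-]].
- by have := lin 1 (evA f t) (evA f u); rewrite scale1r mul1r.
- by have := lin k (evA f t) 0; rewrite chi0 !addr0.
- exact: mul.
Qed.

Lemma character_spaceP : compact K -> homeomorphic_to_character_space A K.
Proof.
move=> cK; exists point_character, character_point; split.
- split; first exact: point_character_is_character.
  by move=> chi /character_pointP[].
- move=> x Kx; have [_ h] := character_pointP (point_character_is_character Kx).
  apply: dual_ball_separates => phi b; rewrite -h //.
  exact: (@point_character_evA _ (TVar phi)).
- move=> chi chiP; apply/funext => a; have [Kx _] := character_pointP chiP.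
  apply: point_character_unique => // e /(generates_approx genf a)[t wt ht] _.
  exists t; split => //; first exact: ltW.
  rewrite -character_evA //; have [lin _] := chiP.
  have -> : chi a - chi (evA f t) = chi (a - evA f t).
    by rewrite addrC -mulN1r -lin scaleN1r addrC.
  exact: le_trans (character_contraction _ chiP) (ltW ht).
(* Continuity of evaluation at [a]: a polynomial in [f] approximates [a] with an error that is
   uniform over [K]. *)
- move=> x0 Kx0 a e e0; have e3 : 0 < e / 3 by rewrite divr_gt0.
  have [t wt ht] := generates_approx genf a e3.
  have [d d0 hd] := evE_continuous x0 wt e3; exists d => // x Kx.
  rewrite nr_le_lt nrB => /hd h.
  have h1 := point_characterP a Kx wt; have h2 := point_characterP a Kx0 wt.
  have := normc_tri (point_character x a) (evE x t) (point_character x0 a).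
  have := normc_tri (evE x t) (evE x0 t) (point_character x0 a).
  rewrite (normcB (evE x t) (evE x0 t)) (normcB (evE x0 t) (point_character x0 a)); lra.
(* Continuity of the inverse uses compactness: finitely many functionals separate [x0] from the
   points of [K] at distance at least [e]. *)
- move=> chi0 chi0P e e0; set x0 := character_point chi0.
  suff [n [a [d [d0 h]]]] : exists n (a : 'I_n -> A) (d : R), 0 < d /\
      forall chi, is_character chi ->
        (forall i, normc (chi (a i) - chi0 (a i)) < d) ->
        K (character_point chi) -> nr (character_point chi - x0) < e.
    exists n, a, d; split => // chi chiP ha; rewrite nr_le_lt.
    by apply: h => //; case: (character_pointP chiP).
  apply: (compact_ind (P := fun S => exists n (a : 'I_n -> A) (d : R), 0 < d /\
      forall chi, is_character chi ->
        (forall i, normc (chi (a i) - chi0 (a i)) < d) ->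
        S (character_point chi) -> nr (character_point chi - x0) < e)) => //.
  + move=> S T ST [n [a [d [d0 h]]]]; exists n, a, d; split => // chi cP ha /ST.
    exact: h.
  + by exists 0%N, (fun=> 0), 1; split.
  + move=> S T [n [a [d [d0 h]]]] [n' [a' [d' [d0' h']]]].
    exists (n + n')%N, (fun i => match fintype.split i with inl j => a j | inr j => a' j end).
    exists (Num.min d d'); split; first by rewrite lt_min d0.
    move=> chi cP ha [Sc|Tc].
      apply: h => // i; have := ha (lshift n' i).
      by rewrite (unsplitK (inl _ i)) lt_min => /andP[].
    apply: h' => // i; have := ha (rshift n i).
    by rewrite (unsplitK (inr _ i)) lt_min => /andP[].
  + move=> y Ky; have [ye|ye] := ltrP (nr (y - x0)) e.
      exists (e - nr (y - x0)); first by lra.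
      exists 0%N, (fun=> 0), 1; split => // chi _ _ [_ h].
      by have := nr_tri (character_point chi) y x0; rewrite (nrB _ y); lra.
    have : exists2 phi, in_dual_ball phi & phi y != phi x0.
      apply: contrapT => h; suff yx : y = x0 by rewrite yx subrr nr0 in ye; lra.
      apply: dual_ball_separates => phi b; apply/eqP; apply: contrapT => /negP yx.
      by apply: h; exists phi.
    move=> [phi b]; rewrite -subr_eq0 -normc_eq0 => yx.
    (* A point closer than [d] to [y] whose value under [phi] is closer than [d] to that of [x0]
       would make the gap smaller than itself, as [phi] is 1-Lipschitz. *)
    pose d := normc (phi y - phi x0) / 2.
    have d0 : 0 < d by rewrite divr_gt0 // lt_def yx normc_ge0.
    exists d => //; exists 1%N, (fun=> f phi), d; split => // chi cP /(_ ord0).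
    rewrite (character_pointP cP).2 // (character_pointP chi0P).2 // => h1 [_ h2].
    have [[lin _] h3] := (in_dual_ballP phi).1 b.
    have := h3 (y - character_point chi); rewrite linear_subr //.
    have := normc_tri (phi y) (phi (character_point chi)) (phi x0).
    by rewrite /d in h1 h2; rewrite -/x0 in h1; lra.
Qed.

End FromAlgebra.

(** * Mazur's theorem *)

Section Mazur.
Variables (R : realType) (E : completeNormedModType R[i]).
Local Notation C := R[i].
Implicit Types (S : set E) (x y z v b : E) (t : R).

Definition cvx S := forall x y t, S x -> S y -> 0 <= t -> t <= 1 ->
  S (x + (t%:C)%C *: (y - x)).

(** The Minkowski sum of [S] and the segment from [- v] to [v]. *)
Definition seg_sum v S := [set x | exists b t, [/\ S b, -1 <= t, t <= 1 & x = b + (t%:C)%C *: v]].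

Lemma seg_sum_compact v S : compact S -> compact (seg_sum v S).
Proof.
move=> cS; pose h (p : E * R) := p.1 + (p.2%:C)%C *: v.
have -> : seg_sum v S = h @` (S `*` `[(-1 : R), 1]%classic).
  apply/seteqP; split => x.
    move=> [b [t [Sb t1 t2 ->]]]; exists (b, t) => //; split => //=.
    by rewrite in_itv /= t1 t2.
  by move=> [[b t] [/= Sb]]; rewrite in_itv /= => /andP[t1 t2] <-; exists b, t.
apply: continuous_compact; last first.
  by apply: compact_setX => //; exact: segment_compact.
apply: continuous_subspaceT => -[b t] B /nbhs_nr[e e0 hB].
have v1 : 0 < nr v + 1 by have := nr_ge0 v; lra.
exists ([set y | nr (b - y) < e / 2], [set s | `|t - s| < e / 2 / (nr v + 1)]).
  split => /=; first by apply/nbhs_nr; exists (e / 2); rewrite ?divr_gt0.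
  apply/nbhs_ballP; exists (e / 2 / (nr v + 1)); first by rewrite /= !divr_gt0.
  by move=> s.
move=> [y s] [/= hy hs]; apply: hB; rewrite /h /= opprD addrACA -scalerBl -rmorphB.
apply: le_lt_trans (nrD _ _) _; rewrite nrZ normc_real.
have : `|t - s| * (nr v + 1) <= e / 2 by rewrite -ler_pdivlMr // ltW.
have := normr_ge0 (t - s); lra.
Qed.

Lemma seg_sum_cvx v S : cvx S -> cvx (seg_sum v S).
Proof.
move=> cS _ _ s [b [t [Sb t1 t2 ->]]] [b' [t' [Sb' t1' t2' ->]]] s0 s1.
exists (b + (s%:C)%C *: (b' - b)), (t + s * (t' - t)); split; [exact: cS|nra|nra|].
by rewrite opprD addrACA -scalerBl scalerDr addrACA scalerA !rmorphD !rmorphM !rmorphB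
  /= scalerDl.
Qed.

Lemma seg_sum_id v S : S `<=` seg_sum v S.
Proof.
by move=> b Sb; exists b, 0; split; rewrite ?scale0r ?addr0 //; lra.
Qed.

(** A compact convex stand-in for the balanced hull of finitely many points: each [v] contributes
    segments along [v] and along ['i *: v], which accommodate the real and imaginary parts of a
    scalar of modulus at most 1. *)
Definition box (s : seq E) := foldr (fun v S => seg_sum v (seg_sum ('i%C *: v) S)) [set 0] s.

Lemma box_compact s : compact (box s).
Proof.
elim: s => [|v s IH] /=; first exact: compact_set1.
by do 2 apply: seg_sum_compact.
Qed.

Lemma box_cvx s : cvx (box s).
Proof.
elim: s => [|v s IH] /=; first by move=> x y t -> -> _ _; rewrite /= subrr scaler0 addr0.
by do 2 apply: seg_sum_cvx.
Qed.

Lemma box0 s : box s 0.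
Proof. by elim: s => //= v s IH; do 2 apply: seg_sum_id. Qed.

Lemma box_mem s v (u : C) : v \in s -> normc u <= 1 -> box s (u *: v).
Proof.
move=> vs u1; elim: s vs => // w s IH; rewrite inE => /orP[/eqP <-|/IH h]; last first.
  by do 2 apply: seg_sum_id.
have := le_trans (normc_ge_Re u) u1; rewrite ler_norml => /andP[r1 r2].
have := le_trans (normc_ge_Im u) u1; rewrite ler_norml => /andP[i1 i2].
exists (((complex.Im u)%:C)%C *: ('i%C *: v)), (complex.Re u); split => //.
  by exists 0, (complex.Im u); split; rewrite ?add0r //; exact: box0.
by rewrite {1}(complexE u) scalerDl scalerA mulrC addrC.
Qed.

(** An ultrafilter on this set, pushed to [B n] by a choice of near points, clusters at some [b],
    and so contains balls about [b] of radius barely above [r n]. It is therefore Cauchy, and its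
    limit is within [r n] of the same [b]. *)
Lemma compact_approximable (B : nat -> set E) (r : nat -> R) :
  (forall n, compact (B n)) -> (forall e, 0 < e -> exists n, r n < e) ->
  compact [set x | forall n, exists2 b, B n b & nr (x - b) <= r n].
Proof.
move=> cB r0; rewrite compact_ultra => F FU FL.
have FP : ProperFilter F by exact: ultra_proper.
have near n : exists2 b, B n b & forall e, 0 < e -> F [set x | nr (x - b) < r n + e].
  have Fn : F [set x | exists2 b, B n b & nr (x - b) <= r n].
    by apply: filterS FL => x; exact.
  pose p x := xget 0 [set b | B n b /\ nr (x - b) <= r n].
  have pP x : (exists2 b, B n b & nr (x - b) <= r n) -> B n (p x) /\ nr (x - p x) <= r n.
    move=> [b Bb h]; exact: (@xgetPex E 0 [set b | B n b /\ nr (x - b) <= r n]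
      (ex_intro _ b (conj Bb h))).
  have FpB : F [set x | B n (p x)] by apply: filterS Fn => x hx; exact: (pP x hx).1.
  have [b [Bb cb]] := cB n (p @ F) _ FpB.
  (* Otherwise the ultrafilter contains the complement of the ball, where the chosen near points
     stay at distance at least [e] from their cluster point [b]. *)
  exists b => // e e0; have [//|Fc] := in_ultra_setVsetC [set x | nr (x - b) < r n + e] FU.
  have Fp : F [set x | e <= nr (p x - b)].
    apply: filterS2 Fn Fc => x /pP[_ h1] /= /negP; rewrite -leNgt => h2.
    by have := nr_tri x (p x) b; rewrite /=; lra.
  have nb : nbhs b [set y | nr (b - y) < e] by apply/nbhs_nr; exists e.
  have [y [/= h1 h2]] := cb [set y | e <= nr (y - b)] _ Fp nb.
  by rewrite nrB in h1; lra.
have Fc : cauchy F.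
  apply: cauchy_exP => e /gt0_complex[e0 ->].
  have e2 : 0 < complex.Re e / 2 by rewrite divr_gt0.
  have [n rn] := r0 _ e2; have [b _ /(_ _ e2) h] := near n.
  exists b; apply: filterS h => x /=; rewrite ball_nr nrB; lra.
have /cvg_ex[/= l Fl] := @cauchy_cvg E F FP Fc.
exists l; split => // n; have [b Bb h] := near n; exists b => //.
apply: (ler_eps (k := 2)) => // e e0 _.
have Fl' : F [set x | nr (l - x) < e] by apply: Fl; apply/nbhs_nr; exists e.
have [x [/= h1 h2]] := @filter_ex _ F FP _ (filterI Fl' (h e e0)).
have := nr_tri l x b; lra.
Qed.

Lemma mazur (K : set E) : compact K -> exists L : set E,
  [/\ compact L, cvx L, L 0 & forall x (u : C), K x -> normc u = 1 -> L (u *: x)].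
Proof.
move=> cK; have ex (n : nat) : exists s : seq E, forall x, K x ->
    exists2 k, k \in s & nr (x - k) < n.+1%:R^-1.
  have [|m [k [_ h]]] := compact_net cK (e := n.+1%:R^-1); first by rewrite invr_gt0.
  exists (codom k) => x /h[i hi]; exists (k i) => //; exact: codom_f.
have [s hs] := choice ex.
(* Points approximable at every scale by the box over a finite net of [K]; convexity and the
   presence of rotations pass from the boxes to this set. *)
exists [set x | forall n, exists2 b, box (s n) b & nr (x - b) <= n.+1%:R^-1]; split.
- apply: compact_approximable => [n|e e0]; first exact: box_compact.
  exists (Num.truncn e^-1); rewrite invf_plt ?posrE ?ltr0n //.
  exact: truncnS_gt.
- move=> x y t hx hy t0 t1 n; have [b Bb h] := hx n; have [b' Bb' h'] := hy n.
  exists (b + (t%:C)%C *: (b' - b)); first exact: box_cvx.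
  have -> : x + (t%:C)%C *: (y - x) - (b + (t%:C)%C *: (b' - b)) =
      ((1 - t)%:C)%C *: (x - b) + (t%:C)%C *: (y - b').
    rewrite opprD addrACA -scalerBr rmorphB /= scalerBl scale1r -[RHS]addrA.
    rewrite (addrC (- (_ *: (x - b)))) -scalerBr; congr (_ + _ *: _).
    by rewrite !opprB addrACA [RHS]addrACA (addrC (- x)).
  apply: le_trans (nrD _ _) _; rewrite !nrZ !normc_real !ger0_norm //; last by lra.
  have -> : (n.+1%:R^-1 : R) = (1 - t) * n.+1%:R^-1 + t * n.+1%:R^-1 by rewrite -mulrDl subrK mul1r.
  by rewrite lerD // ler_wpM2l //; lra.
- by move=> n; exists 0; [exact: box0|rewrite subrr nr0].
- move=> x u Kx u1 n; have [k ks hk] := hs n x Kx.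
  exists (u *: k); first by apply: box_mem ks _; rewrite u1.
  by rewrite -scalerBr nrZ u1 mul1r ltW.
Qed.
End Mazur.

(** * Representing a spectral point by a vector *)

Section Representation.
Variables (R : realType) (E : completeNormedModType R[i]) (K : set E).
Local Notation C := R[i].
Implicit Types (x y z : E) (t : term R E) (phi : E -> C).
Hypothesis cK : compact K.
Variable lambda : (E -> C) -> C.
Hypothesis lambda_bound : forall t (B : R), wf t -> 0 <= B ->
  (forall x, K x -> normc (evE x t) <= B) -> normc (evC lambda t) <= B.

Lemma normc_sqrD (a b : C) :
  (normc (a + b)) ^+ 2 = (normc a) ^+ 2 + 2 * complex.Re ((a^*)%C * b) + (normc b) ^+ 2.
Proof. by rewrite !normc_sqr; case: a b => [a1 a2] [b1 b2] /=; ring. Qed.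

Lemma evC_sum (l : (E -> C) -> C) m (c : 'I_m -> C) (phi : 'I_m -> E -> C) :
  evC l (\big[@TAdd R E/TScale 0 TOne]_(i < m) TScale (c i) (TVar (phi i))) =
  \sum_(i < m) c i * l (phi i).
Proof. by rewrite (big_morph (evC l) (id1 := 0) (op1 := +%R)) //= mul0r. Qed.

Lemma wf_sum m (c : 'I_m -> C) (phi : 'I_m -> E -> C) :
  (forall i, in_dual_ball (phi i)) ->
  wf (\big[@TAdd R E/TScale 0 TOne]_(i < m) TScale (c i) (TVar (phi i))).
Proof. by move=> h; elim/big_ind: _ => // i _; exact: h. Qed.

(** * Least squares at finitely many functionals *)

Section Interpolation.
Variables (L : set E) (m : nat) (phi : 'I_m -> E -> C).
Hypotheses (cL : compact L) (cvxL : cvx L) (L0 : L 0)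
  (LK : forall x (u : C), K x -> normc u = 1 -> L (u *: x))
  (phib : forall i, in_dual_ball (phi i)).

Let gap x i : C := phi i x - lambda (phi i).
Let G x : R := \sum_(i < m) (normc (gap x i)) ^+ 2.

Lemma gap_minimizer : exists2 z, L z & forall y, L y -> G z <= G y.
Proof.
apply: contrapT => nomin.
(* A compactness argument on subsets strictly beaten by one point of [L]: beating all of [L], that
   point would beat itself. *)
suff [y Ly h] : exists2 y, L y & forall x, L x -> G y < G x by have := h y Ly; rewrite ltxx.
apply: (compact_ind (P := fun S => exists2 y, L y & forall x, S x -> G y < G x)) => //.
- by move=> S T ST [y Ly h]; exists y => // x /ST; exact: h.
- by exists 0.
- move=> S T [y Ly h] [y' Ly' h']; have [yy|yy] := lerP (G y) (G y').
    by exists y => // x [/h//|/h']; exact: le_lt_trans.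
  by exists y' => // x [/h|/h'//]; exact: lt_trans.
- move=> x Lx; have [y Ly yx] : exists2 y, L y & G y < G x.
    apply: contrapT => h; apply: nomin; exists x => // y Ly.
    by rewrite leNgt; apply/negP => yx; apply: h; exists y.
  (* Since gaps move by at most [nr (x - w)], each square drops by at most
     [2 * normc (gap x i) * nr (x - w)]; the final 1 keeps [M] positive. *)
  pose M := \sum_(i < m) 2 * normc (gap x i) + 1.
  have M0 : 0 < M.
    by rewrite ltr_wpDl // sumr_ge0 // => i _; rewrite mulr_ge0 ?normc_ge0.
  exists ((G x - G y) / M); first by rewrite divr_gt0 // subr_gt0.
  exists y => // w [Lw]; rewrite ltr_pdivlMr // => xw.
  suff : G x <= G w + nr (x - w) * M by lra.
  rewrite /M mulrDr mulr1 mulr_sumr addrA -big_split /=.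
  apply: ler_wpDr; first exact: nr_ge0.
  apply: ler_sum => i _.
  have [[lin _] h] := (in_dual_ballP (phi i)).1 (phib i).
  have h1 : normc (gap x i) <= normc (gap w i) + nr (x - w).
    have -> : gap x i = gap w i + phi i (x - w) by rewrite /gap linear_subr //; ring.
    by apply: le_trans (normcD _ _) _; rewrite lerD2l.
  have := normc_ge0 (gap x i); have := normc_ge0 (gap w i); have := nr_ge0 (x - w).
  by have [|] := lerP (nr (x - w)) (normc (gap x i)); nra.
Qed.

(* First-order optimality at a nearest point z of L says that the functional w with
   coefficients the conjugate gaps satisfies |w| <= Re w(z) on K, whence
   |lambda w| <= Re w(z), while lambda w - w(z) is the squared distance. *)
Lemma interpolation : exists2 z, L z & forall i, phi i z = lambda (phi i).
Proof.
have [z Lz zmin] := gap_minimizer; exists z => //.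
have lin i : clinear_fun (phi i) by have [[]] := phib i.
pose w x := \sum_(i < m) (- (gap z i)^*)%C * phi i x.
have wlin a x y : w (a *: x + y) = a * w x + w y.
  rewrite /w mulr_sumr -big_split; apply: eq_bigr => i _; rewrite /= lin; ring.
have opt y : L y -> complex.Re (w y) <= complex.Re (w z).
  move=> Ly; have -> : w z = w y - w (y - z).
    by rewrite -[in w y](subrK z y) -[y - z]scale1r wlin scale1r mul1r; ring.
  suff : complex.Re (w (y - z)) <= 0 by rewrite raddfB /=; lra.
  pose Q := \sum_(i < m) (normc (phi i (y - z))) ^+ 2.
  have Q0 : 0 <= Q by apply: sumr_ge0 => i _; exact: sqr_ge0.
  apply: (ler_eps (k := Q) Q0) => e e0 e1; rewrite add0r.
  have := zmin _ (cvxL Lz Ly (ltW e0) e1).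
  (* Minimality along the segment gives [2 * Re (w (y - z)) <= e * Q], and [e] tends to 0. *)
  have -> : G (z + (e%:C)%C *: (y - z)) =
      G z - 2 * e * complex.Re (w (y - z)) + e ^+ 2 * Q.
    rewrite /G /Q /w raddf_sum mulr_sumr mulr_sumr -sumrB -big_split.
    apply: eq_bigr => i _ /=.
    have -> : gap (z + (e%:C)%C *: (y - z)) i = gap z i + (e%:C)%C * phi i (y - z).
      by rewrite /gap [z + _]addrC lin; ring.
    rewrite normc_sqrD normcM normc_real gtr0_norm //.
    by case: (gap z i) (phi i (y - z)) => [a b] [c d] /=; ring.
  nra.
have w0 : 0 <= complex.Re (w z).
  have := opt _ L0; suff -> : w 0 = 0 by [].
  by have := wlin (-1) 0 0; rewrite scaler0 addr0 mulN1r addrC subrr.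
have wK x : K x -> normc (w x) <= complex.Re (w z).
  move=> Kx; have [->|wx] := eqVneq (w x) 0; first by rewrite normc0.
  pose u : C := ((normc (w x))%:C)%C / w x.
  have u1 : normc u = 1.
    by rewrite normcM normcV normc_real ger0_norm ?normc_ge0 // mulfV // normc_eq0.
  have := opt _ (LK Kx u1); have -> : w (u *: x) = ((normc (w x))%:C)%C.
    have := wlin u x 0; rewrite !addr0 => ->.
    have -> : w 0 = 0 by have := wlin (-1) 0 0; rewrite scaler0 addr0 mulN1r addrC subrr.
    by rewrite addr0 divfK.
  by [].
have := @lambda_bound _ _ (wf_sum (fun i => (- (gap z i)^*)%C) phib) w0.
rewrite evC_sum => bnd.
have {}bnd : normc (\sum_(i < m) (- (gap z i)^*)%C * lambda (phi i)) <= complex.Re (w z).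
  by apply: bnd => x Kx; rewrite /evE evC_sum; exact: wK.
have := le_trans (normc_ge_Re _) bnd.
rewrite ler_norml => /andP[_].
have -> : complex.Re (\sum_(i < m) (- (gap z i)^*)%C * lambda (phi i)) =
    complex.Re (w z) + G z.
  rewrite /w /G !raddf_sum -big_split; apply: eq_bigr => i _ /=.
  rewrite normc_sqr /gap.
  by case: (phi i z) (lambda (phi i)) => [a b] [c d] /=; ring.
move=> Gz i; have {}Gz : G z <= 0 by lra.
have : (normc (gap z i)) ^+ 2 <= 0.
  apply: le_trans Gz; rewrite /G (bigD1 i) //= lerDl.
  by apply: sumr_ge0 => j _; exact: sqr_ge0.
move=> g0; apply/eqP; rewrite -subr_eq0 -/(gap z i) -normc_eq0.
by rewrite -sqrf_eq0 eq_le g0 sqr_ge0.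
Qed.

End Interpolation.

(** If every point of [L] missed [lambda] at some functional, finitely many functionals would detect
    this on all of [L] by compactness, against interpolation. *)
Lemma representation : exists x, forall phi, in_dual_ball phi -> phi x = lambda phi.
Proof.
have [L [cL cvxL L0 LK]] := mazur cK.
suff [x _ h] : exists2 x, L x & forall phi, in_dual_ball phi -> phi x = lambda phi by exists x.
apply: contrapT => no.
suff [m [phi [b h]]] : exists m (phi : 'I_m -> E -> C), (forall i, in_dual_ball (phi i)) /\
    forall x, L x -> exists i, phi i x != lambda (phi i).
  have [z Lz hz] := interpolation cL cvxL L0 LK b.
  by case: (h z Lz) => i; rewrite hz eqxx.
apply: (compact_ind (P := fun S => exists m (phi : 'I_m -> E -> C),
    (forall i, in_dual_ball (phi i)) /\
    forall x, S x -> exists i, phi i x != lambda (phi i))) => //.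
- by move=> S T ST [m [phi [b h]]]; exists m, phi; split => // x /ST; exact: h.
- by exists 0%N, (fun=> fun=> 0); split => [[]//|x []].
- move=> S T [m [phi [b h]]] [n [psi [b' h']]].
  exists (m + n)%N, (fun i => match fintype.split i with inl j => phi j | inr j => psi j end).
  split; first by move=> i; case: fintype.split.
  move=> x [/h|/h'] [i hi].
    by exists (lshift n i); rewrite (unsplitK (inl _ i)).
  by exists (rshift m i); rewrite (unsplitK (inr _ i)).
- move=> x Lx; have [phi b px] : exists2 phi, in_dual_ball phi & phi x != lambda phi.
    apply: contrapT => h; apply: no; exists x => // phi b; apply/eqP/negPn/negP => hh.
    by apply: h; exists phi.
  rewrite -subr_eq0 -normc_eq0 in px.
  exists (normc (phi x - lambda phi)); first by rewrite lt_def px normc_ge0.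
  exists 1%N, (fun=> phi); split => // y [Ly xy]; exists ord0.
  have [[lin _] h] := (in_dual_ballP phi).1 b.
  apply/eqP => py; rewrite -py -linear_subr // in xy.
  by have := h (x - y); lra.
Qed.

End Representation.

(** * The uniform closure of the polynomials on K *)

Section PolyClosure.
Variables (R : realType) (E : completeNormedModType R[i]) (K : set E).
Local Notation C := R[i].
Implicit Types (x y : E) (t u : term R E).

(** Elements of the closure in [C(K)] are encoded as functions on [E] extended by 0, so that
    agreement on [K] is equality and the sup norm is definite. *)
Definition poly_closure_pred : {pred E -> C} := fun a => `[< [/\
  forall x, ~ K x -> a x = 0,
  exists M, forall x, K x -> normc (a x) <= M &
  forall e : R, 0 < e -> exists2 t, wf t & forall x, K x -> normc (a x - evE x t) <= e] >].

Lemma poly_closureP (a : E -> C) : a \in poly_closure_pred <-> [/\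
  forall x, ~ K x -> a x = 0,
  exists M, forall x, K x -> normc (a x) <= M &
  forall e : R, 0 < e -> exists2 t, wf t & forall x, K x -> normc (a x - evE x t) <= e].
Proof. by split => /asboolP. Qed.

Lemma poly_closure_submod : submod_closed poly_closure_pred.
Proof.
split.
  apply/poly_closureP; split => //; first by exists 0 => x _; rewrite normc0.
  move=> e e0; exists (TScale 0 TOne) => // x _.
  rewrite [X in normc X](_ : _ = 0) ?normc0 ?(ltW e0) //.
  by rewrite /evE /= mul0r subr0.
move=> k a b /poly_closureP[a0 [M hM] ha] /poly_closureP[b0 [N hN] hb].
apply/poly_closureP; split.
- by move=> x Kx; rewrite /= -[LHS]/(k * a x + b x) a0 // b0 // mulr0 addr0.
- exists (normc k * M + N) => x Kx; rewrite -[X in normc X]/(k * a x + b x).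
  apply: le_trans (normcD _ _) _; rewrite normcM lerD ?hN //.
  by rewrite ler_wpM2l ?normc_ge0 ?hM.
- move=> e e0; have k1 : 0 < normc k + 1 by have := normc_ge0 k; lra.
  pose d := e / (normc k + 1); have d0 : 0 < d by rewrite divr_gt0.
  have dE : d * (normc k + 1) = e by rewrite divfK // lt0r_neq0.
  have [t wt ht] := ha d d0; have [u wu hu] := hb d d0.
  exists (TAdd (TScale k t) u) => // x Kx.
  have -> : (k *: a + b) x - evE x (TAdd (TScale k t) u) =
    k * (a x - evE x t) + (b x - evE x u).
    by rewrite -[X in X - _]/(k * a x + b x) /evE /=; ring.
  apply: le_trans (normcD _ _) _; rewrite normcM.
  have := ht x Kx; have := hu x Kx; have := normc_ge0 k; nra.
Qed.

HB.instance Definition _ :=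
  GRing.isSubmodClosed.Build C (E -> C) poly_closure_pred poly_closure_submod.

Record poly_closure := PolyClosure {
  poly_closure_val :> E -> C; _ : poly_closure_val \in poly_closure_pred }.

HB.instance Definition _ := [isSub for poly_closure_val].
HB.instance Definition _ := [Choice of poly_closure by <:].
HB.instance Definition _ := [SubChoice_isSubLmodule of poly_closure by <:].

Implicit Types (a b : poly_closure).

Lemma poly_closure_valP a : [/\
  forall x, ~ K x -> a x = 0,
  exists M, forall x, K x -> normc (a x) <= M &
  forall e : R, 0 < e -> exists2 t, wf t & forall x, K x -> normc (a x - evE x t) <= e].
Proof. by apply/poly_closureP; exact: (valP a). Qed.

Lemma poly_closure_add a b x : (a + b) x = a x + b x.
Proof. by []. Qed.

Lemma poly_closure_scale (k : C) a x : (k *: a) x = k * a x.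
Proof. by []. Qed.

Lemma poly_closure_sub a b x : (a - b) x = a x - b x.
Proof. by []. Qed.

Lemma poly_closure_eq a b : (forall x, K x -> a x = b x) -> a = b.
Proof.
move=> h; apply: val_inj; apply/funext => x; have [/h//|nK] := pselect (K x).
have [ha _ _] := poly_closure_valP a; have [hb _ _] := poly_closure_valP b.
exact: etrans (ha x nK) (esym (hb x nK)).
Qed.

Definition sup_norm a : R := sup [set normc (a x) | x in K].

Lemma sup_norm_empty a : ~ (exists x, K x) -> sup_norm a = 0.
Proof.
move=> nK; have K0 : K = set0 by apply/seteqP; split => // x Kx; apply: nK; exists x.
by rewrite /sup_norm K0 image_set0 sup0.
Qed.

Lemma le_sup_norm a x : K x -> normc (a x) <= sup_norm a.
Proof.
move=> Kx; apply: ub_le_sup; last by exists x.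
have [_ [M h] _] := poly_closure_valP a.
by exists M => _ [y Ky <-]; exact: h.
Qed.

Lemma sup_norm_le a M : 0 <= M -> (forall x, K x -> normc (a x) <= M) -> sup_norm a <= M.
Proof.
move=> M0 h; have [[x Kx]|nK] := pselect (exists x, K x).
  apply: ge_sup; first by exists (normc (a x)), x.
  by move=> _ [y Ky <-]; exact: h.
by rewrite sup_norm_empty.
Qed.

Lemma sup_norm_ge0 a : 0 <= sup_norm a.
Proof.
have [[x Kx]|nK] := pselect (exists x, K x).
  exact: le_trans (normc_ge0 _) (le_sup_norm a Kx).
by rewrite sup_norm_empty.
Qed.

Let norm a : C := ((sup_norm a)%:C)%C.

Let normD a b : norm (a + b) <= norm a + norm b.
Proof.
rewrite -rmorphD lecR; apply: sup_norm_le; first by rewrite addr_ge0 ?sup_norm_ge0.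
move=> x Kx; rewrite poly_closure_add.
by apply: le_trans (normcD _ _) _; rewrite lerD ?le_sup_norm.
Qed.

Let normZ (k : C) a : norm (k *: a) = `|k| * norm a.
Proof.
rewrite abs_normcE -rmorphM; congr (_%:C)%C; apply/eqP; rewrite eq_le.
apply/andP; split.
  apply: sup_norm_le; first by rewrite mulr_ge0 ?normc_ge0 ?sup_norm_ge0.
  by move=> x Kx; rewrite poly_closure_scale normcM ler_wpM2l ?normc_ge0 ?le_sup_norm.
have [->|k0] := eqVneq k 0; first by rewrite normc0 mul0r sup_norm_ge0.
have kp : 0 < normc k by rewrite lt_def normc_eq0 k0 normc_ge0.
rewrite -ler_pdivlMl //; apply: sup_norm_le.
  by rewrite mulr_ge0 ?invr_ge0 ?normc_ge0 ?sup_norm_ge0.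
move=> x Kx; rewrite ler_pdivlMl // -normcM -poly_closure_scale.
exact: le_sup_norm.
Qed.

Let norm_eq0 a : norm a = 0 -> a = 0.
Proof.
move=> [h]; apply: poly_closure_eq => x Kx; apply/eqP; rewrite -normc_eq0 eq_le.
by rewrite normc_ge0 andbT -h le_sup_norm.
Qed.

HB.instance Definition _ := Lmodule_isNormed.Build C poly_closure normD normZ norm_eq0.

Lemma nr_poly_closure a : nr a = sup_norm a.
Proof. by []. Qed.

Lemma poly_closure_complete (F : set_system poly_closure) :
  ProperFilter F -> cauchy F -> cvg F.
Proof.
move=> FF /cauchyP Fc.
have app (e : R) : 0 < e -> exists a, F [set b | nr (a - b) < e].
  move=> e0; have [|a Fa] := Fc (e%:C)%C; first by rewrite ltcR.
  by exists a; apply: filterS Fa => b; rewrite ball_nr.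
(* Pointwise limits with uniform error: [a x] is an approximation of error [e] as soon as the ball
   of radius [e] about [a] belongs to [F]. *)
have pt x : exists c, K x -> forall (e : R) a, F [set b | nr (a - b) < e] ->
    normc (c - a x) <= e.
  have [Kx|nK] := pselect (K x); last by exists 0.
  have [||c hc] := @complex_approx R (fun e v =>
      exists a, F [set b | nr (a - b) < e] /\ v = a x).
  - by move=> e /app[a Fa]; exists (a x), a.
  - move=> e d _ _ [a [Fa ->]] [b [Fb ->]].
    have [c [/= h1 h2]] := @filter_ex _ F FF _ (filterI Fa Fb).
    have := le_sup_norm (a - c) Kx; have := le_sup_norm (b - c) Kx.
    rewrite -!nr_poly_closure !poly_closure_sub.
    have := normc_tri (a x) (c x) (b x); rewrite (normcB (c x)); lra.
  by exists c => _ e a Fa; apply: hc; exists a.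
have [l hl] := choice pt.
pose l0 x := if `[< K x >] then l x else 0.
have l0E x : K x -> l0 x = l x by move=> Kx; rewrite /l0; case: asboolP.
have l0P : l0 \in poly_closure_pred.
  apply/poly_closureP; split.
  - by move=> x nK; rewrite /l0; case: asboolP.
  - have [a Fa] := app 1 ltr01; exists (1 + sup_norm a) => x Kx; rewrite l0E //.
    have := hl x Kx 1 a Fa; have := le_sup_norm a Kx.
    by have := normcD (l x - a x) (a x); rewrite subrK; lra.
  - move=> e e0; have e2 : 0 < e / 2 by rewrite divr_gt0.
    have [a Fa] := app _ e2; have [_ _ /(_ _ e2)[t wt ht]] := poly_closure_valP a.
    exists t => // x Kx; rewrite l0E //.
    have := hl x Kx _ a Fa; have := ht x Kx.
    by have := normc_tri (l x) (a x) (evE x t); lra.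
apply/cvg_ex; exists (PolyClosure l0P) => B /nbhs_nr[e e0 hB].
have e3 : 0 < e / 3 by rewrite divr_gt0.
have [a Fa] := app _ e3.
have : nr (PolyClosure l0P - a) <= e / 3.
  apply: sup_norm_le; first exact: ltW.
  by move=> x Kx; rewrite poly_closure_sub /= l0E //; exact: hl.
move=> la; apply: filterS Fa => b /= ab; apply: hB.
have := nr_tri (PolyClosure l0P) a b; lra.
Qed.

HB.instance Definition _ := Uniform_isComplete.Build poly_closure poly_closure_complete.

Lemma poly_closure_mul_subproof a b : (fun x => a x * b x) \in poly_closure_pred.
Proof.
have [a0 [M hM] ha] := poly_closure_valP a; have [_ [N hN] hb] := poly_closure_valP b.
apply/poly_closureP; split.
- by move=> x nK; rewrite a0 ?mul0r.
- exists (M * N) => x Kx; rewrite normcM ler_pM ?normc_ge0 ?hM ?hN //.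
- move=> e e0; pose T := `|M| + `|N| + 1.
  have T1 : 1 <= T by rewrite /T; have := normr_ge0 M; have := normr_ge0 N; lra.
  pose d := Num.min 1 (e / T); have d0 : 0 < d by rewrite lt_min ltr01 divr_gt0 //; lra.
  have d1 : d <= 1 by rewrite ge_min lexx.
  have dT : d * T <= e by rewrite -ler_pdivlMr ?ge_min ?lexx ?orbT //; lra.
  have [t wt ht] := ha d d0; have [u wu hu] := hb d d0.
  exists (TMul t u) => // x Kx.
  have -> : a x * b x - evE x (TMul t u) =
    a x * (b x - evE x u) + (a x - evE x t) * evE x u by rewrite /evE /=; ring.
  apply: le_trans (normcD _ _) _; rewrite !normcM.
  have h1 := ht x Kx; have h2 := hu x Kx.
  have h3 : normc (a x) <= `|M| by exact: le_trans (hM x Kx) (ler_norm _).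
  have h4 : normc (evE x u) <= `|N| + 1.
    have := normcD (evE x u - b x) (b x); rewrite subrK normcB.
    by have := hN x Kx; have := ler_norm N; lra.
  have h5 : normc (a x) * normc (b x - evE x u) <= `|M| * d.
    by rewrite ler_pM ?normc_ge0.
  have h6 : normc (a x - evE x t) * normc (evE x u) <= d * (`|N| + 1).
    by rewrite ler_pM ?normc_ge0.
  by rewrite /T in dT; lra.
Qed.

Definition poly_closure_mul a b := PolyClosure (poly_closure_mul_subproof a b).

Definition restr (g : E -> C) : E -> C := fun x => if `[< K x >] then g x else 0.

Lemma restrE g x : K x -> restr g x = g x.
Proof. by move=> Kx; rewrite /restr; case: asboolP. Qed.

Lemma poly_closure_one_subproof : restr (fun=> 1) \in poly_closure_pred.
Proof.
apply/poly_closureP; split.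
- by move=> x nK; rewrite /restr; case: asboolP.
- by exists 1 => x Kx; rewrite restrE // normc1.
- move=> e e0; exists TOne => // x Kx; rewrite restrE //.
  by rewrite [evE _ _]/(1 : C) subrr normc0 ltW.
Qed.

Definition poly_closure_one := PolyClosure poly_closure_one_subproof.

Lemma poly_closure_mulA a b c : poly_closure_mul a (poly_closure_mul b c) =
  poly_closure_mul (poly_closure_mul a b) c.
Proof. by apply: poly_closure_eq => x _; exact: mulrA. Qed.

Lemma poly_closure_mulC a b : poly_closure_mul a b = poly_closure_mul b a.
Proof. by apply: poly_closure_eq => x _; exact: mulrC. Qed.

Lemma poly_closure_mul1 a : poly_closure_mul poly_closure_one a = a.
Proof. by apply: poly_closure_eq => x Kx; rewrite /= restrE // mul1r. Qed.

Lemma poly_closure_mulDl a b c : poly_closure_mul (a + b) c =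
  poly_closure_mul a c + poly_closure_mul b c.
Proof. by apply: poly_closure_eq => x Kx; exact: mulrDl. Qed.

Lemma poly_closure_mulZl (k : C) a b : poly_closure_mul (k *: a) b =
  k *: poly_closure_mul a b.
Proof. by apply: poly_closure_eq => x Kx; rewrite poly_closure_scale /= -mulrA. Qed.

Lemma poly_closure_norm_mul a b : `|poly_closure_mul a b| <= `|a| * `|b|.
Proof.
rewrite !nrE -rmorphM lecR; apply: sup_norm_le.
  by rewrite mulr_ge0 ?nr_ge0.
by move=> x Kx; rewrite /= normcM ler_pM ?normc_ge0 //; exact: le_sup_norm.
Qed.

Definition poly_closure_alg : BanachAlg R := {|
  ba_car := poly_closure : completeNormedModType C;
  ba_mulA := poly_closure_mulA; ba_mulC := poly_closure_mulC;
  ba_mul1 := poly_closure_mul1; ba_mulDl := poly_closure_mulDl;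
  ba_mulZl := poly_closure_mulZl; ba_norm_mul := poly_closure_norm_mul |}.

(** Total in [phi], as the type of [f] requires; the default 0 is taken when the restriction lies
    outside the algebra, which never happens on the dual ball for compact [K]. *)
Definition restriction (phi : E -> C) : poly_closure_alg := insubd (0 : poly_closure) (restr phi).

Hypothesis cK : compact K.

Lemma restrictionE phi x : in_dual_ball phi -> K x ->
  (restriction phi : poly_closure) x = phi x.
Proof.
move=> b Kx; rewrite /restriction /insubd insubT /= ?restrE //.
have [M M0 hM] := compact_nr_bounded cK.
apply/poly_closureP; split.
- by move=> y nK; rewrite /restr; case: asboolP.
- exists M => y Ky; rewrite restrE //; apply: le_trans (hM y Ky).
  exact: ((in_dual_ballP phi).1 b).2.
- by move=> e e0; exists (TVar phi) => // y Ky; rewrite restrE // subrr normc0 ltW.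
Qed.

Lemma evA_restriction t x : wf t -> K x ->
  (evA restriction t : poly_closure) x = evE x t.
Proof.
move=> + Kx; elim: t => [_|phi b|t IHt u IHu [/IHt ht /IHu hu]|k t IH /IH h|
  t IHt u IHu [/IHt ht /IHu hu]].
- by rewrite /= restrE.
- exact: restrictionE.
- by rewrite /evE /= -!/(evE _ _) -ht -hu.
- by rewrite /evE /= -!/(evE _ _) -h.
- by rewrite /evE /= -!/(evE _ _) -ht -hu.
Qed.

(** The dual ball is equicontinuous: closeness on a finite [eps / 4]-net of [K] gives closeness
    within [3 * (eps / 4)] on all of [K]. *)
Lemma restriction_weakstar : weakstar_continuous restriction.
Proof.
move=> phi0 b0 eps eps0; have e4 : 0 < eps / 4 by rewrite divr_gt0.
have [n [k [Kk net]]] := compact_net cK e4.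
exists n, k, (eps / 4); split => // phi b close; rewrite nr_le_lt.
apply: (@le_lt_trans _ _ (3 * (eps / 4))); last by lra.
apply: sup_norm_le; first by lra.
move=> x Kx; rewrite poly_closure_sub !restrictionE //; have [i xi] := net x Kx.
have [[lin _] h] := (in_dual_ballP phi).1 b.
have [[lin0 _] h0] := (in_dual_ballP phi0).1 b0.
have := h (x - k i); have := h0 (k i - x); rewrite !linear_subr // (nrB (k i)).
have := close i; have := normc_tri (phi x) (phi (k i)) (phi0 x).
have := normc_tri (phi (k i)) (phi0 (k i)) (phi0 x); lra.
Qed.

Lemma restriction_generates : generates (restriction @` in_dual_ball (E:=E)).
Proof.
apply/seteqP; split => // a _ B /nbhs_nr[e e0 hB].
have e2 : 0 < e / 2 by rewrite divr_gt0.
have [_ _ /(_ _ e2)[t wt ht]] := poly_closure_valP a.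
exists (evA restriction t); split; first by apply/alg_gen_term; exists t.
apply: hB; apply: (@le_lt_trans _ _ (e / 2)); last by lra.
apply: sup_norm_le; first exact: ltW.
by move=> x Kx; rewrite poly_closure_sub evA_restriction //; exact: ht.
Qed.

Lemma restriction_spectrum : poly_convex K -> spectrum_is K restriction.
Proof.
move=> pc lambda; split; last first.
  move=> [x Kx h]; apply/in_joint_spectrumP => si.
  (* Evaluation at [x] annihilates the ideal, but not the unit. *)
  suff : (ba_one poly_closure_alg : poly_closure) x = 0.
    by rewrite /= restrE // => /eqP; rewrite oner_eq0.
  elim: si => [//|a phi b dphi _ IH].
  rewrite poly_closure_add IH addr0 -[LHS]/((a : poly_closure) x * (lambda phi *:
    poly_closure_one - restriction phi : poly_closure) x).
  by rewrite poly_closure_sub poly_closure_scale restrictionE // /= restrE // h //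
    mulr1 subrr mulr0.
move=> sl.
have bound t (B : R) : wf t -> 0 <= B -> (forall x, K x -> normc (evE x t) <= B) ->
    normc (evC lambda t) <= B.
  move=> wt B0 hB; apply: le_trans (spectrum_bound sl wt) _; apply: sup_norm_le => // x Kx.
  by rewrite evA_restriction //; exact: hB.
have [x xE] := representation cK bound.
exists x => [|phi b]; last by rewrite xE.
(* For empty [K] the bound would give the constant 1 modulus at most 0. A point of [K] also makes a
   finite supremum nonnegative and excludes the value minus infinity. *)
have [[y Ky]|nK] := pselect (exists y, K y); last first.
  have : normc (evC lambda TOne) <= 0 by apply: bound => // y Ky; case: nK; exists y.
  by rewrite [evC _ _]/(1 : C) normc1 ler10.
rewrite pc => P /finite_type_term[t wt PE].
have -> : P x = evC lambda t.
  by rewrite PE; apply: eq_evC => // phi b; exact: xE.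
have ub z : K z -> ((normc (P z))%:E <= ereal_sup [set (normc (P y))%:E | y in K])%E.
  by move=> Kz; apply: ereal_sup_ubound; exists z.
move: ub; case: (ereal_sup _) => [r|_|ub]; last by have := ub y Ky.
  move=> ub; rewrite lee_fin; apply: bound => //.
    by have := ub y Ky; rewrite lee_fin; apply: le_trans; exact: normc_ge0.
  by move=> z Kz; rewrite -PE -lee_fin; exact: ub.
by rewrite leey.
Qed.

End PolyClosure.

Theorem theorem3p4 (R : realType) (E : completeNormedModType R[i]) (K : set E) :
  compact K ->
  (poly_convex K <->
     exists (A : BanachAlg R) (f : (E -> R[i]) -> A), condition_ii K f) /\
  (forall (A : BanachAlg R) (f : (E -> R[i]) -> A),
     condition_ii K f -> homeomorphic_to_character_space A K).
Proof.
move=> cK; split; last by move=> A f [_ gen spec]; exact: character_spaceP gen spec cK.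
split=> [pc|[A [f [_ gen spec]]]]; last exact: spectrum_poly_convex gen spec.
exists (poly_closure_alg K), (@restriction R E K); split.
- exact: restriction_weakstar.
- exact: restriction_generates.
- exact: restriction_spectrum.
Qed.
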